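(* Let $\mathcal{H}$ be a separable Hilbert space with orthonormal basis $(e_j)_{j\in\mathbb{N}}$, write $\widehat{u}(j)=\langle u,e_j\rangle_{\mathcal{H}}$ for $u\in\mathcal{H}$, and let $\mathcal{A}:\mathcal{D}(\mathcal{A})\subset\mathcal{H}\to\mathcal{H}$ be the operator $\mathcal{A}u=\sum_{j\in\mathbb{N}}\lambda_j^2\,\widehat{u}(j)e_j$ for a sequence of real numbers $(\lambda_j^2)_{j\in\mathbb{N}}$. Let $a:[0,T]\to\mathbb{R}$ be a Log-Lipschitz function such that $a(t)>a_0>0$. Suppose $(u_0,u_1)\in \mathcal{H}^{s}_{\mathcal{A}}\times \mathcal{H}^{s-1}_{\mathcal{A}}$ for some $s\in\mathbb{R}$. Then the Cauchy problem of finding $u:[0,T]\to\mathcal{H}$ such that $$\begin{cases}\partial_t^2u(t)+a(t)\mathcal{A}u(t)=0,& t\in[0,T],\\ u(0)=u_0,\\ \partial_tu(0)=u_1,\end{cases}$$ has a unique solution satisfying $$\|u(t)\|_{\mathcal{H}^{s-\frac{\delta}{2}T}_{\mathcal{A}}}^2+\|\partial_tu(t)\|_{\mathcal{H}^{s-\frac{\delta}{2}T-1}_{\mathcal{A}}}^2\le C\left(\|u_0\|_{\mathcal{H}^{s}_{\mathcal{A}}}^2+\|u_1\|_{\mathcal{H}^{s-1}_{\mathcal{A}}}^2\right),$$ for some $C,\delta>0$ independent of $u_0$, $u_1$, and $t\in[0,T]$.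
   Context: Log-Lipschitz means that there is a constant $C_a>0$ such that $|a(t)-a(r)|\le C_a|t-r|\,\big|\log|t-r|\big|$ for all $t,r\in[0,T]$. The Sobolev spaces induced by $\mathcal{A}$ are $\mathcal{H}^0_{\mathcal{A}}:=\mathcal{H}$ and, for $s\in\mathbb{R}$, $\mathcal{H}^s_{\mathcal{A}}:=\{u\in\mathcal{H}:\sum_{j\in\mathbb{N}}\lambda_j^{2s}|\widehat{u}(j)|^2<\infty\}$, with $\|u\|_{\mathcal{H}^s_{\mathcal{A}}}^2=\sum_{j\in\mathbb{N}}\lambda_j^{2s}|\widehat{u}(j)|^2$. Note that $\widehat{\mathcal{A}u}(j)=\lambda_j^2\widehat{u}(j)$.
   Formalization: The eigenvalues λ_j² are assumed bounded below by some c>0 (if λ_j→0 the estimate already fails at t=0), and for negative order the Sobolev spaces, hence the values of the solution, are taken in the completion of H (formal series with finite norm). *)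

(* Defs.v *)
From HB Require Import structures.
From mathcomp Require Import all_boot all_order all_algebra.
From mathcomp Require Import all_classical all_reals all_analysis.
From mathcomp Require Import complex.

Set Implicit Arguments.
Unset Strict Implicit.
Unset Printing Implicit Defensive.

Import Order.TTheory GRing.Theory Num.Theory.
Import numFieldNormedType.Exports.

Local Open Scope classical_set_scope.
Local Open Scope ring_scope.

(* The Hilbert space may be real or complex. *)
Variant scalar_kind := RealScalars | ComplexScalars.

Definition scalarField (R : realType) (k : scalar_kind) : numFieldType :=
  match k with RealScalars => R : numFieldType
             | ComplexScalars => R[i] : numFieldType end.

Definition conjS (R : realType) (k : scalar_kind) :
    scalarField R k -> scalarField R k :=
  match k with RealScalars => fun x : R => x
             | ComplexScalars => fun z : R[i] => z^*%C end.

Definition ofR (R : realType) (k : scalar_kind) : R -> scalarField R k :=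
  match k with RealScalars => fun x : R => x
             | ComplexScalars => fun x : R => x%:C%C end.

(* The library norm on [scalarField R k] takes its values in [scalarField R k];
   this is the same norm, valued in [R]. *)
Definition absS (R : realType) (k : scalar_kind) : scalarField R k -> R :=
  match k with RealScalars => fun x : R => `|x|
             | ComplexScalars => fun z : R[i] => complex.Re `|z| end.

Section HilbertSpace.
Variables (R : realType) (k : scalar_kind).
Variables (H : completeNormedModType (scalarField R k)).
Variables (dot : {dot H for @conjS R k}).

(* Together with completeness of [H], this makes [H] a Hilbert space. *)
Definition norm_from_dot := forall u : H, `|u| ^+ 2 = dot u u.

Definition fourier (e : nat -> H) (u : H) : nat -> scalarField R k :=
  fun j => dot u (e j).

(* An orthonormal sequence in which every vector is the sum of its Fourier
   series; its existence makes [H] separable. *)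
Definition orthonormal_basis (e : nat -> H) :=
  (forall i j, dot (e i) (e j) = (i == j)%:R) /\
  (forall u, series (fun j => fourier e u j *: e j) @ \oo --> u).

Section Operator.
Variables (e : nat -> H) (lam : nat -> R).

Definition opA_terms (u : H) : nat -> H :=
  fun j => (ofR k (lam j ^+ 2) * fourier e u j) *: e j.

Definition opA_dom : set H := [set u | cvgn (series (opA_terms u))].

Definition opA (u : H) : H := limn (series (opA_terms u)).

End Operator.
End HilbertSpace.

(* For unbounded lam the spaces of negative order have to contain more than H:
   with a = 1, u0 in H^0 and u1 in H^(-1), the derivative u'(t) need not be in
   H, nor u(t) in the domain of A.  Elements of every Sobolev space are
   therefore represented by their Fourier coefficients, as formal series
   \sum_j (w j) e_j. *)
Section SobolevScale.
Variables (R : realType) (k : scalar_kind) (lam : nat -> R).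
Implicit Types (s : R) (w : nat -> scalarField R k).

(* The squared norm of order s, where lam_j^(2s) is read as (lam_j^2)^s. *)
Definition sobolev_sqnorm s w : \bar R :=
  (\sum_(j <oo) ((lam j ^+ 2) `^ s * absS (w j) ^+ 2)%:E)%E.

(* For s >= 0 these are the u in H with finite norm of order s; for s < 0,
   the formal series with finite norm of order s, which form the completion
   of H for that norm. *)
Definition sobolev (H : completeNormedModType (scalarField R k))
    (dot : {dot H for @conjS R k}) (e : nat -> H) s :
    set (nat -> scalarField R k) :=
  [set w | (sobolev_sqnorm s w < +oo)%E /\
           (0 <= s -> exists u : H, w = fourier dot e u)].

(* Extension of [opA] to formal series, see [fourier_opA]. *)
Definition extA w : nat -> scalarField R k := fun j => ofR k (lam j ^+ 2) * w j.

(* [du] is the derivative of [u] on [0, T] (one-sided at the endpoints) for the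
   norm of order [r]. *)
Definition sobolev_derivative (T r : R) (u du : R -> nat -> scalarField R k) :=
  forall t : R, 0 <= t <= T ->
    sobolev_sqnorm r
      (fun j => ofR k h^-1 * (u (t + h) j - u t j) - du t j)
      @[h --> within [set h | 0 <= t + h <= T] 0^'] --> 0%E.

End SobolevScale.

(* [u], with time derivative [du], solves on [0, T]
     u'' + a(t) A u = 0,  u(0) = u0,  u'(0) = u1,
   with u(t) in H^r, u'(t) in H^(r-1), and u'' = - a A u in H^(r-2). *)
Record cauchy_solution (R : realType) (k : scalar_kind)
    (H : completeNormedModType (scalarField R k)) (dot : {dot H for @conjS R k})
    (e : nat -> H) (lam : nat -> R) (T : R) (a : R -> R)
    (u0 u1 : nat -> scalarField R k) (r : R)
    (u du : R -> nat -> scalarField R k) : Prop := CauchySolution {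
  solution_mem : forall t : R, 0 <= t <= T ->
    sobolev lam dot e r (u t) ;
  solution_dmem : forall t : R, 0 <= t <= T ->
    sobolev lam dot e (r - 1) (du t) ;
  solution_deriv : sobolev_derivative lam T (r - 1) u du ;
  solution_eq : sobolev_derivative lam T (r - 2) du
                  (fun t j => - (ofR k (a t) * extA lam (u t) j)) ;
  solution_init : u 0 = u0 ;
  solution_dinit : du 0 = u1
}.

Definition log_lipschitz (R : realType) (T : R) (a : R -> R) :=
  exists2 Ca : R, 0 < Ca & forall t r : R, 0 <= t <= T -> 0 <= r <= T ->
    `|a t - a r| <= Ca * `|t - r| * `|ln `|t - r| |.

Lemma conjS_norm (R : realType) (k : scalar_kind) (x : scalarField R k) :
  x * conjS x = `|x| ^+ 2.
Proof.
case: k x => x.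
  by rewrite /= -expr2; exact/esym/real_normK/num_real.
by rewrite sqr_normc.
Qed.

Section FourierA.
Variables (R : realType) (k : scalar_kind).
Variables (H : completeNormedModType (scalarField R k)).
Variables (dot : {dot H for @conjS R k}).

Lemma bessel1 (hdot : norm_from_dot dot) (x e : H) :
  dot e e = 1 -> `|dot x e| <= `|x|.
Proof.
move=> ee; rewrite -(@ler_pXn2r _ 2) ?nnegrE// hdot -conjS_norm.
have : 0 <= `|x - dot x e *: e| ^+ 2 by rewrite exprn_ge0.
rewrite hdot linearBl !linearBr /= !linearZr_LR !linearZl_LR /= !linearZr_LR ee.
rewrite /= mulr1 (hermitian_subproof e x) /= mul1r.
by rewrite [conjS _ * _]mulrC subrr subr0 subr_ge0.
Qed.

Variables (e : nat -> H) (lam : nat -> R).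

Lemma fourier_opA u : norm_from_dot dot -> orthonormal_basis dot e ->
  opA_dom dot e lam u ->
  fourier dot e (opA dot e lam u) = extA lam (fourier dot e u).
Proof.
move=> hdot [eON _] cu; apply/funext => m; apply/eqP.
rewrite -subr_eq0 -normr_le0.
apply/ler_addgt0Pr => eps eps0; rewrite add0r.
have /cvgrPdist_le /(_ _ eps0) [n _ hn] :
  series (opA_terms dot e lam u) @ \oo --> opA dot e lam u by exact: cu.
have {hn} := hn (maxn n m.+1) (leq_maxl _ _).
apply: le_trans; set S := series _ _.
suff <- : dot S (e m) = extA lam (fourier dot e u) m.
  by rewrite -linearBl; apply: bessel1 => //; rewrite eON eqxx.
rewrite /S /series /= linear_sumlz (bigD1_seq m) ?iota_uniq //=; last first.
  by rewrite mem_index_iota leq_maxr.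
rewrite big1 ?addr0 => [|i im].
all: by rewrite linearZl_LR /= eON ?eqxx ?(negbTE im) ?mulr1 ?mulr0.
Qed.

End FourierA.

(* Main.v *)
Require Import Defs.
From HB Require Import structures.
From mathcomp Require Import all_boot all_order all_algebra.
From mathcomp Require Import all_classical all_reals all_analysis.
From mathcomp Require Import complex ring lra.

(** Expansion in the basis decouples the problem: the [j]-th coefficient of a
    solution satisfies the scalar equation [w'' + a(t) lam_j^2 w = 0]. The theorem
    is an estimate for this equation that is explicit in the frequency
    [m = |lam_j|], summed over [j].

    The estimate. For a differentiable coefficient the energy
    [m^2 a f^2 + (f')^2] grows at a rate bounded by [|a'| / a], uniformly in [m].
    A log-Lipschitz coefficient has no such derivative, so inside the energy [a]
    is replaced by its mean [h] over a window of length [ep]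
    ([log_lipschitz_mollify]). Then [h'] is of size [ln (1 / ep)], while the error
    [h - a], of size [ep * ln (1 / ep)], enters the derivative of the energy with
    a factor [m]. At [ep ~ 1 / m] both contributions are of size [ln m]
    ([energy_rate]), and Gronwall's lemma bounds the energy at time [t] by
    [exp (K t ln m) = m^(K t)] times the initial energy. This is a loss of
    [K T / 2] derivatives up to time [T], and [delta = K] depends only on the
    coefficient ([energy_estimate]).

    Existence. Each scalar equation has solutions with given data, by Picard
    iteration ([oscillator_exists]); [u] is the superposition of these solutions
    with the coefficients of the data. The estimate turns the norms of the data
    into a summable majorant, independent of [t], of the norms of [u] and [u'] in
    the lower order [s - delta T / 2]. The same majorant dominates the difference
    quotients, so the time derivatives exist in the Sobolev norms by dominated
    convergence ([sobolev_derivative_series]). When the order is nonnegative,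
    elements of the Hilbert space come from the Riesz-Fischer theorem
    ([riesz_fischer]).

    Uniqueness. A solution of any order has coefficients whose real and imaginary
    parts solve the scalar equation ([cauchy_solution_part]), and the estimate
    with zero initial data shows that two of them with the same data agree. *)

Set Implicit Arguments.
Unset Strict Implicit.
Unset Printing Implicit Defensive.

Import Order.TTheory GRing.Theory Num.Theory.
Import numFieldNormedType.Exports.

Local Open Scope classical_set_scope.
Local Open Scope ring_scope.

(** * Calculus on a segment *)

Section Calculus.
Variable R : realType.

Lemma is_derive_within_continuous (x y : R) (f df : R -> R) :
  (forall t : R, x <= t <= y -> is_derive t 1 f (df t)) ->
  {within `[x, y], continuous f}.
Proof.
move=> fd; apply: continuous_in_subspaceT => t; rewrite inE /= in_itv /= => txy.
apply: differentiable_continuous; apply/derivable1_diffP.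
by have [] := fd t txy.
Qed.

(** Integrating from [-1] rather than from [0] makes [0] an interior point, so
    that the derivative is two-sided on all of [0, oo[. *)
Lemma antiderivative (f : R -> R) : continuous f ->
  exists F : R -> R, F 0 = 0 /\ forall x : R, -1 < x -> is_derive x 1 F (f x).
Proof.
move=> cf.
pose G x :=
  (\int[lebesgue_measure]_(t in [set` Interval (BLeft (-1 : R)) (BRight x)]) f t)%R.
have dG (x : R) : -1 < x -> is_derive x 1 G (f x).
  move=> x1.
  have [] := @continuous_FTC1 R f (BLeft (-1)) x (x + 1) _ _ _ (cf x).
  - by rewrite ltrDl.
  - apply: continuous_compact_integrable; first exact: segment_compact.
    exact: continuous_subspaceT.
  - by rewrite lte_fin.
  by move=> dF FE; apply: DeriveDef; [exact: dF|rewrite -derive1E; exact: FE].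
exists (fun x => G x - G 0); split; first by rewrite subrr.
move=> x x1; have dGx := dG x x1; apply: is_derive_eq.
by rewrite subr0.
Qed.

Lemma within_continuousM (A : set R) (f g : R -> R) :
  {within A, continuous f} -> {within A, continuous g} ->
  {within A, continuous (fun x => f x * g x)}.
Proof. by move=> cf cg x; apply: cvgM; [exact: cf|exact: cg]. Qed.

(** The derivative is only asked for in the open interval, so that the lemma
    also applies to functions with one-sided derivatives at the endpoints. *)
Lemma gronwall (f df : R -> R) (T K : R) :
  {within `[0, T], continuous f} ->
  (forall t : R, t \in `]0, T[ -> is_derive t 1 f (df t)) ->
  (forall t, t \in `]0, T[ -> df t <= K * f t) ->
  forall t, 0 <= t <= T -> f t <= f 0 * expR (K * t).
Proof.
move=> cf fd dfK t /andP[t0 tT].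
pose g x := f x * expR (- (K * x)).
have gd (x : R) : x \in `]0, T[ -> is_derive x 1 g ((df x - K * f x) * expR (- (K * x))).
  move=> xT; have fdx := fd x xT.
  apply: is_derive_eq; rewrite /GRing.scale /=; ring.
have cg : {within `[0, T], continuous g}.
  apply: within_continuousM => //.
  apply: continuous_subspaceT => x.
  apply: continuous_comp; last exact: continuous_expR.
  by apply: continuousN; apply: continuousM; [exact: cst_continuous|].
have : g t <= g 0.
  apply: (@ler0_derive1_le_cc _ g 0 T).
  - by move=> x /gd [].
  - move=> x xT; rewrite derive1E (@derive_val _ _ _ _ _ _ _ (gd x xT)).
    by apply: mulr_le0_ge0; rewrite ?expR_ge0// subr_le0 dfK.
  - exact: cg.
  - by rewrite in_itv /= t0 tT.
  - by rewrite in_itv /= lexx (le_trans t0).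
  - exact: t0.
rewrite /g mulr0 oppr0 expR0 mulr1 expRN => h.
by rewrite -ler_pdivrMr ?expR_gt0.
Qed.

Lemma mulr_normln_le1 (y : R) : 0 <= y <= 1 -> y * `|ln y| <= 1.
Proof.
move=> /andP[y0 y1]; have [->|yn0] := eqVneq y 0; first by rewrite mul0r.
have yp : 0 < y by rewrite lt_neqAle eq_sym yn0.
rewrite ler0_norm ?ln_le0// -lnV//.
have /ltW h : ln y^-1 < y^-1 by rewrite ln_sublinear// invr_gt0.
by rewrite (le_trans (ler_wpM2l y0 h))// divff.
Qed.

(** With [x = y * expR (- L)] one has [ln x = ln y - L], and [y * `|ln y| <= 1];
    this replaces a discussion of the monotonicity of [x * `|ln x|]. *)
Lemma mulr_normln_expRN (x L : R) : 1 <= L -> 0 <= x <= expR (- L) ->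
  x * `|ln x| <= 2 * L * expR (- L).
Proof.
move=> L1 /andP[x0 xL]; have [->|xn0] := eqVneq x 0.
  by rewrite mul0r !mulr_ge0 ?expR_ge0//; lra.
have xp : 0 < x by rewrite lt_neqAle eq_sym xn0.
set y := x * expR L.
have y01 : 0 <= y <= 1.
  rewrite /y mulr_ge0 ?expR_ge0//= -[leRHS](@expRxMexpNx_1 R L) mulrC.
  by rewrite ler_wpM2l// expR_ge0.
have xE : x = y * expR (- L).
  by rewrite /y -mulrA expRxMexpNx_1 mulr1.
have yp : 0 < y by rewrite mulr_gt0// expR_gt0.
have lnE : `|ln x| <= `|ln y| + L.
  rewrite {1}xE lnM ?posrE ?expR_gt0// expRK (le_trans (ler_normD _ _))//.
  by rewrite normrN lerD2l ger0_norm//; lra.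
rewrite (le_trans (ler_wpM2l x0 lnE))// {1}xE mulrAC ler_wpM2r ?expR_ge0//.
have := mulr_normln_le1 y01; move: y01 => /andP[yge yle].
have : y * L <= 1 * L by rewrite ler_wpM2r//; lra.
by rewrite mulrDr; lra.
Qed.

Lemma mulr_expRN_le (L : R) : 0 < L -> L * expR (- L) <= 2 / L.
Proof.
move=> L0; have h := @expR_ge1Dxn R L 1 (ltW L0).
rewrite expRN ler_pdivrMr ?expR_gt0// mulrAC ler_pdivlMr//.
by move: h; rewrite (_ : 2`!%:R = 2 :> R)// expr2; lra.
Qed.

(** * Log-Lipschitz coefficients *)

(** Composition with this retraction of the line onto [0, T] extends a function
    from [0, T] to the line and keeps its modulus of continuity. *)
Definition clamp (T x : R) : R := Num.max 0 (Num.min x T).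

Lemma clamp_itv T x : 0 <= T -> 0 <= clamp T x <= T.
Proof. by move=> T0; rewrite /clamp le_max lexx /= ge_max T0 ge_min lexx orbT. Qed.

Lemma clamp_id T x : 0 <= x <= T -> clamp T x = x.
Proof. by move=> /andP[x0 xT]; rewrite /clamp min_l// max_r. Qed.

Lemma clamp_dist T x y : `|clamp T x - clamp T y| <= `|x - y|.
Proof.
wlog xy : x y / x <= y.
  by move=> h; case/orP: (le_total x y) => /h //; rewrite distrC (distrC y).
rewrite !(distrC x) (distrC (clamp T x)) (@ger0_norm _ (y - x)) ?subr_ge0//.
rewrite /clamp; have [xT|xT] := leP x T; have [yT|yT] := leP y T.
- have [x0|x0] := leP 0 x; have [y0|y0] := leP 0 y; rewrite ler_norml; lra.
- have [x0|x0] := leP 0 x; have [y0|y0] := leP 0 T; rewrite ler_norml; lra.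
- lra.
- rewrite subrr normr0; lra.
Qed.

Lemma clamp_continuous T : continuous (clamp T).
Proof.
move=> x; apply/cvgrPdist_le => e e0.
have cid : y @[y --> x] --> x by exact: cvg_id.
have xe := (cvgrPdist_le _ _).1 cid e e0.
near=> y; apply: le_trans (clamp_dist _ _ _) _.
by near: y; exact: xe.
Unshelve. all: end_near. Qed.

Section LogLipschitz.
Variables (T : R) (a : R -> R).

(** At distance [expR (- L)], the modulus of continuity is [L * expR (- L)]; the
    factor 2 pays for the distances smaller than [expR (- L)]. *)
Lemma log_lipschitz_clamp Ca : 0 < T ->
  (forall t r : R, 0 <= t <= T -> 0 <= r <= T ->
    `|a t - a r| <= Ca * `|t - r| * `|ln `|t - r| |) -> 0 < Ca ->
  forall L x y, 1 <= L -> `|x - y| <= expR (- L) ->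
  `|a (clamp T x) - a (clamp T y)| <= Ca * (2 * L * expR (- L)).
Proof.
move=> T0 aC C0 L x y L1 xy.
rewrite (le_trans (aC _ _ (clamp_itv _ (ltW T0)) (clamp_itv _ (ltW T0))))//.
rewrite -mulrA ler_pM2l//; apply: mulr_normln_expRN => //.
by rewrite normr_ge0 (le_trans (clamp_dist _ _ _)).
Qed.

Lemma log_lipschitz_continuous : 0 < T -> log_lipschitz T a ->
  continuous (a \o clamp T).
Proof.
move=> T0 [Ca C0 aC] x; apply/cvgrPdist_le => e e0.
pose L := 1 + 4 * Ca / e.
have q0 : 0 < 4 * Ca / e by rewrite divr_gt0// mulr_gt0.
have L1 : 1 <= L by rewrite /L; lra.
have cid : y @[y --> x] --> x by exact: cvg_id.
have xe := (cvgrPdist_le _ _).1 cid _ (expR_gt0 (- L)).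
near=> y; apply: (@le_trans _ _ (Ca * (2 * L * expR (- L)))).
  by apply: log_lipschitz_clamp => //; near: y; exact: xe.
have -> : Ca * (2 * L * expR (- L)) = (2 * Ca) * (L * expR (- L)) by ring.
have /(@mulr_expRN_le) h : 0 < L by lra.
have C20 : 0 <= 2 * Ca by lra.
rewrite (le_trans (ler_wpM2l C20 h))// mulrA ler_pdivrMr; last by lra.
have -> : e * L = e + 4 * Ca by rewrite /L; field; rewrite gt_eqF.
lra.
Unshelve. all: end_near. Qed.

Lemma log_lipschitz_bounded : 0 < T -> log_lipschitz T a ->
  exists A, forall t, 0 <= t <= T -> `|a t| <= A.
Proof.
move=> T0 [Ca C0 aC]; exists (`|a 0| + Ca * (1 + T ^+ 2)) => t /andP[t0 tT].
have -> : a t = a 0 + (a t - a 0) by ring.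
rewrite (le_trans (ler_normD _ _))// lerD2l.
have := aC t 0; rewrite t0 tT lexx (ltW T0) subr0 => /(_ isT isT)/le_trans.
apply; rewrite -mulrA ler_pM2l//.
rewrite (ger0_norm t0); have T2 : 0 <= T ^+ 2 by rewrite sqr_ge0.
have [t1|t1] := leP t 1.
  by have := @mulr_normln_le1 t; rewrite t0 t1 => /(_ isT); lra.
rewrite (ger0_norm (ln_ge0 (ltW t1))).
have /ltW h : ln t < t by apply: ln_sublinear; lra.
apply: (@le_trans _ _ (t * t)); first by rewrite ler_wpM2l.
have : t * t <= T * T by rewrite ler_pM.
by rewrite expr2; lra.
Qed.

End LogLipschitz.
End Calculus.

(** * Existence for one oscillator *)

Section Existence.
Variable R : realType.

Lemma divr_exp2_le (M e : R) : 0 < e -> exists n, M / 2 ^+ n <= e.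
Proof.
move=> e0; pose n := (Num.truncn (M / e)).+1; exists n.
rewrite ler_pdivrMr ?exprn_gt0// -ler_pdivrMl// mulrC ltW//.
rewrite (lt_le_trans (truncnS_gt _))// -natrX ler_nat ltnW//.
by rewrite ltn_expl.
Qed.

(** The sequences [p n t - 2 * M / 2 ^+ n] and [p n t + 2 * M / 2 ^+ n] are
    adjacent, so the supremum of the former lies between them. *)
Lemma continuous_geometric_limit (p : nat -> R -> R) (M : R) :
  (forall n, continuous (p n)) ->
  (forall n t, `|p n.+1 t - p n t| <= M / 2 ^+ n) ->
  exists q, continuous q /\ forall n t, `|q t - p n t| <= 2 * M / 2 ^+ n.
Proof.
move=> cp dp.
pose u n t := p n t - 2 * M / 2 ^+ n; pose v n t := p n t + 2 * M / 2 ^+ n.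
have M0 : 0 <= M.
  by have := le_trans (normr_ge0 _) (dp 0%N 0); rewrite expr0 divr1.
have h2 n : M / 2 ^+ n.+1 = M / 2 ^+ n / 2.
  by rewrite exprSr invfM mulrA.
have uS n t : u n t <= u n.+1 t.
  have := dp n t; rewrite /u -!mulrA h2 ler_norml => /andP[]; lra.
have vS n t : v n.+1 t <= v n t.
  have := dp n t; rewrite /v -!mulrA h2 ler_norml => /andP[]; lra.
have umono t : nondecreasing_seq (u ^~ t) by apply/nondecreasing_seqP.
have vmono t : nonincreasing_seq (v ^~ t) by apply/nonincreasing_seqP.
have uv m n t : u m t <= v n t.
  rewrite (le_trans (umono t _ _ (leq_maxl m n)))//.
  rewrite (le_trans _ (vmono t _ _ (leq_maxr m n)))//.
  have : 0 <= M / 2 ^+ maxn m n by rewrite divr_ge0.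
  by rewrite /u /v -!mulrA; lra.
pose q t := sup (range (u ^~ t)).
have qp n t : `|q t - p n t| <= 2 * M / 2 ^+ n.
  have : u n t <= q t.
    apply: ub_le_sup; last by exists n.
    by exists (v 0%N t) => _ [m _ <-].
  have : q t <= v n t.
    apply: ge_sup; first by exists (u 0%N t), 0%N.
    by move=> _ [m _ <-].
  by rewrite /u /v ler_norml; lra.
exists q; split=> // t; apply/cvgrPdist_le => e e0.
have [n ne] := divr_exp2_le (2 * M) (divr_gt0 e0 (ltr0n _ 3)).
have pe := (cvgrPdist_le _ _).1 (cp n t) _ (divr_gt0 e0 (ltr0n _ 3)).
near=> s.
have -> : q t - q s = (q t - p n t) + (p n t - p n s) + (p n s - q s) by ring.
rewrite (le_trans (ler_normD _ _))// (_ : e = e / 3 + e / 3 + e / 3); last by field.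
rewrite lerD//; last by rewrite distrC (le_trans (qp n s)).
rewrite (le_trans (ler_normD _ _))// lerD//; first exact: le_trans ne.
by near: s; exact: pe.
Unshelve. all: end_near. Qed.

(** Integration gains a factor [1 / L] in the norm weighted by [expR (- L * t)].
    This makes the Picard operator a contraction on the whole of [0, T],
    whatever the length of that segment. *)
Lemma antiderivative_expR_bound (T L M : R) (F f : R -> R) : 0 < L ->
  F 0 = 0 ->
  (forall t : R, 0 <= t <= T -> is_derive t 1 F (f t)) ->
  (forall t, 0 <= t <= T -> `|f t| <= M * expR (L * t)) ->
  forall t, 0 <= t <= T -> `|F t| <= M / L * expR (L * t).
Proof.
move=> L0 F0 dF fM t /andP[t0 tT].
have M0 : 0 <= M.
  have := fM 0; rewrite lexx (le_trans t0 tT) mulr0 expR0 mulr1 => /(_ isT).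
  exact: le_trans.
have key (s : R) : `|s| = 1 -> s * F t <= M / L * expR (L * t).
  move=> s1; pose g x := M / L * expR (L * x) - s * F x.
  have sub x : x \in `]0, t[ -> 0 <= x <= T.
    by rewrite in_itv /= => /andP[x0 xt]; rewrite !ltW// (lt_le_trans xt).
  have sub' x : 0 <= x <= t -> 0 <= x <= T.
    by move=> /andP[-> /= xt]; exact: le_trans xt tT.
  have dg (x : R) : 0 <= x <= T -> is_derive x 1 g (M * expR (L * x) - s * f x).
    move=> xT; have dFx := dF x xT; apply: is_derive_eq.
    rewrite /GRing.scale /=; field.
    by rewrite gt_eqF.
  have : g 0 <= g t.
    apply: (@ger0_derive1_le_cc _ g 0 t).
    - by move=> x /sub xT; have [] := dg x xT.
    - move=> x /sub xT; rewrite derive1E (@derive_val _ _ _ _ _ _ _ (dg x xT)).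
      rewrite subr_ge0 (le_trans (ler_norm _))// normrM s1 mul1r.
      exact: fM.
    - apply: (is_derive_within_continuous (df := fun x => M * expR (L * x) - s * f x)).
      by move=> x /sub' xT; exact: dg.
    - by rewrite in_itv /= lexx t0.
    - by rewrite in_itv /= t0 lexx.
    - exact: t0.
  rewrite /g F0 !mulr0 expR0 subr0 mulr1.
  have : 0 <= M / L by rewrite divr_ge0// ltW.
  lra.
rewrite ler_norml lerNl; apply/andP; split.
  by rewrite -mulN1r key// normrN1.
by rewrite -[F t]mul1r key// normr1.
Qed.

(** The equation is the fixed point equation [f = x0 + y0 * t - J (J (b * f))],
    with [J] the antiderivative vanishing at 0. In the norm weighted by
    [expR (- (B + 1) * t)] the double integral contracts by
    [B / (B + 1) ^+ 2 <= 1 / 2]. Each iterate is composed with [clamp T], so that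
    it stays continuous on the line, where [J] is defined. *)
Lemma oscillator_exists (T B : R) (b : R -> R) (x0 y0 : R) : 0 <= T ->
  continuous b -> (forall t, 0 <= t <= T -> `|b t| <= B) ->
  exists f g : R -> R, [/\ f 0 = x0, g 0 = y0 &
    forall t : R, 0 <= t <= T ->
      is_derive t 1 f (g t) /\ is_derive t 1 g (- (b t * f t))].
Proof.
move=> T0 cb bB.
have [J J0 dJ] : exists2 J : (R -> R) -> R -> R,
    forall f, continuous f -> J f 0 = 0 &
    forall f, continuous f -> forall x : R, -1 < x -> is_derive x 1 (J f) (f x).
  have : forall f : R -> R, exists F : R -> R, continuous f ->
      F 0 = 0 /\ forall x : R, -1 < x -> is_derive x 1 F (f x).
    move=> f; case: (pselect (continuous f)) => [cf|ncf].
      by have [F FP] := antiderivative cf; exists F.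
    by exists f.
  by move=> /choice[J JP]; exists J => f /JP[].
have B0 : 0 <= B.
  by apply: le_trans (bB 0 _); rewrite ?normr_ge0// lexx T0.
have dJT f (t : R) : continuous f -> 0 <= t <= T -> is_derive t 1 (J f) (f t).
  by move=> cf /andP[t0 _]; apply: dJ => //; lra.
have cJ f : continuous f -> continuous (J f \o clamp T).
  move=> cf t; apply: continuous_comp; first exact: clamp_continuous.
  apply: differentiable_continuous; apply/derivable1_diffP.
  by have [] := dJT f (clamp T t) cf (clamp_itv _ T0).
pose bp p : R -> R := fun t => b t * p t.
have cbp p : continuous p -> continuous (bp p).
  by move=> cp t; apply: continuousM; [exact: cb|exact: cp].
pose K p := J (J (bp p) \o clamp T).
pose Phi p := (fun t => x0 + y0 * t - K p t) \o clamp T.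
have cPhi p : continuous p -> continuous (Phi p).
  move=> cp t; apply: continuous_comp; first exact: clamp_continuous.
  apply: differentiable_continuous; apply/derivable1_diffP.
  have [? _] := dJT _ (clamp T t) (cJ _ (cbp _ cp)) (clamp_itv _ T0).
  by apply: derivableB; [exact: derivableD|].
pose L := B + 1; have L0 : 0 < L by rewrite /L; lra.
have KL p q M : continuous p -> continuous q ->
    (forall t, 0 <= t <= T -> `|p t - q t| <= M * expR (L * t)) ->
    forall t, 0 <= t <= T -> `|K p t - K q t| <= M / 2 * expR (L * t).
  move=> cp cq pq.
  have M0 : 0 <= M.
    have := pq 0; rewrite lexx T0 mulr0 expR0 mulr1 => /(_ isT).
    exact: le_trans.
  have h1 t : 0 <= t <= T ->
      `|J (bp p) t - J (bp q) t| <= B * M / L * expR (L * t).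
    apply: (@antiderivative_expR_bound T L (B * M) (fun t => J (bp p) t - J (bp q) t)
        (fun t => bp p t - bp q t)) => //.
    - by rewrite !J0 ?subrr//; exact: cbp.
    - move=> s sT; have d1 := dJT _ s (cbp _ cp) sT.
      by have d2 := dJT _ s (cbp _ cq) sT; exact: is_deriveB.
    - move=> s sT; rewrite /bp -mulrBr normrM -mulrA ler_pM ?normr_ge0 ?bB ?pq//.
  move=> t tT.
  have := @antiderivative_expR_bound T L (B * M / L)
      (fun t => K p t - K q t)
      (fun t => J (bp p) (clamp T t) - J (bp q) (clamp T t)) L0.
  have cp' := cJ _ (cbp _ cp); have cq' := cJ _ (cbp _ cq).
  rewrite /K !J0 ?subrr// => /(_ erefl) h; apply: le_trans (h _ _ t tT) _.
  - move=> s sT; have d1 := dJT _ s cp' sT; have d2 := dJT _ s cq' sT.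
    exact: is_deriveB.
  - by move=> s sT; rewrite clamp_id//; exact: h1.
  - rewrite ler_wpM2r ?expR_ge0// !ler_pdivrMr// /L.
    nra.
pose p n := iter n Phi (fun=> 0).
have cp n : continuous (p n).
  by elim: n => [|n ih]; [exact: cst_continuous|exact: cPhi].
have clampK t : clamp T (clamp T t) = clamp T t by rewrite clamp_id// clamp_itv.
have pclamp n t : p n (clamp T t) = p n t.
  by case: n => [//|n]; rewrite /p /= /Phi /= clampK.
pose M0 := `|x0| + `|y0| * T.
have K0 t : 0 <= t <= T -> K (fun=> 0) t = 0.
  move=> tT; apply/eqP; rewrite -normr_le0.
  have cz : continuous (fun _ : R => 0 : R) by exact: cst_continuous.
  have cz' : continuous (bp (fun=> 0)) by exact: cbp.
  have z1 s : 0 <= s <= T -> `|J (bp (fun=> 0)) s| <= 0 * expR (L * s).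
    move=> sT; rewrite -[X in X * _](mul0r L^-1).
    apply: (@antiderivative_expR_bound T L 0 _ (bp (fun=> 0))) => //.
    - exact: J0.
    - by move=> r rT; apply: dJT.
    - by move=> r _; rewrite /bp mulr0 normr0 mul0r.
  have := @antiderivative_expR_bound T L 0 (K (fun=> 0)) _ L0 (J0 _ (cJ _ cz')).
  move=> /(_ _ (fun s => dJT _ s (cJ _ cz'))) h; apply: le_trans (h _ t tT) _.
    by move=> s sT /=; rewrite clamp_id// z1.
  by rewrite !mul0r.
have dp n t : 0 <= t <= T -> `|p n.+1 t - p n t| <= M0 / 2 ^+ n * expR (L * t).
  elim: n t => [|n ih] t tT; rewrite /p /= /Phi /= clamp_id//.
    rewrite subr0 K0// subr0 expr0 divr1.
    apply: (@le_trans _ _ M0).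
      rewrite (le_trans (ler_normD _ _))// lerD2l normrM ler_wpM2l//.
      by move: tT => /andP[t0 tT]; rewrite ger0_norm.
    rewrite ler_peMr ?addr_ge0 ?mulr_ge0//.
    move: tT => /andP[t0 _]; rewrite (le_trans _ (expR_ge1Dx _))// lerDl.
    by rewrite mulr_ge0// ltW.
  rewrite opprD opprK addrACA subrr add0r addrC distrC /=.
  rewrite exprSr invfM mulrA; by apply: (KL _ _ _ (cp n.+1) (cp n)).
have [q [cq qp]] : exists q, continuous q /\
    forall n t, `|q t - p n t| <= 2 * (M0 * expR (L * T)) / 2 ^+ n.
  apply: continuous_geometric_limit => // n t.
  rewrite -(pclamp n.+1) -(pclamp n) (le_trans (dp _ _ (clamp_itv _ T0)))//.
  rewrite mulrAC ler_wpM2r ?invr_ge0 ?exprn_ge0// ler_wpM2l//.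
    by rewrite addr_ge0// mulr_ge0.
  by rewrite ler_expR ler_pM2l//; have /andP[] := clamp_itv t T0.
have qE t : 0 <= t <= T -> q t = x0 + y0 * t - K q t.
  move=> tT; apply/eqP; rewrite -subr_eq0 -normr_le0.
  apply/ler_addgt0Pr => e e0; rewrite add0r.
  set M1 := 2 * (M0 * expR (L * T)) in qp.
  have M10 : 0 <= M1.
    by rewrite /M1 mulr_ge0// mulr_ge0 ?expR_ge0// addr_ge0// mulr_ge0.
  have [n ne] := divr_exp2_le (M1 / 2 + M1 / 2 * expR (L * t)) e0.
  apply: le_trans ne.
  have pE : p n.+1 t = x0 + y0 * t - K (p n) t by rewrite /p /= /Phi /= clamp_id.
  have -> : q t - (x0 + y0 * t - K q t) =
      (q t - p n.+1 t) + (K q t - K (p n) t) by rewrite pE; ring.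
  rewrite (le_trans (ler_normD _ _))// [leRHS]mulrDl lerD//.
    by rewrite (le_trans (qp _ _))// exprS invfM mulrA.
  have -> : M1 / 2 * expR (L * t) / 2 ^+ n = M1 / 2 ^+ n / 2 * expR (L * t).
    by rewrite mulrAC (mulrAC M1).
  apply: KL => // s sT; rewrite (le_trans (qp _ _))// ler_peMr ?divr_ge0//.
  move: sT => /andP[s0 _]; rewrite (le_trans _ (expR_ge1Dx _))// lerDl.
  by rewrite mulr_ge0// ltW.
have cJq := cJ _ (cbp _ cq).
exists (fun t => x0 + y0 * t - K q t), (fun t => y0 - J (bp q) t); split.
- by rewrite /K J0// mulr0 addr0 subr0.
- by rewrite J0 ?subr0//; exact: cbp.
- move=> t tT; have d1 := dJT _ t cJq tT; have d2 := dJT _ t (cbp _ cq) tT.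
  split; rewrite /K.
    have dl : is_derive t 1 (fun s : R => x0 + y0 * s) y0.
      by apply: is_derive_eq; rewrite /GRing.scale /=; ring.
    by apply: is_derive_eq; rewrite /= clamp_id.
  have dy : is_derive t 1 (fun _ : R => y0) 0 by exact: is_derive_cst.
  apply: is_derive_eq (is_deriveB dy d2) _.
  by rewrite -qE// /bp add0r.
Qed.

End Existence.

(** * Energy estimate with loss for a log-Lipschitz coefficient *)

Section Energy.
Variable R : realType.

(** [h] is the mean of [a] over the window [t, t + expR (- L)], written as a
    difference quotient of an antiderivative. Then [h'] is a difference quotient
    of [a] itself, and by the mean value theorem [h] takes values of [a]. *)
Lemma log_lipschitz_mollify (T Ca L : R) (a : R -> R) : 0 < T ->
  0 < Ca ->
  (forall t r : R, 0 <= t <= T -> 0 <= r <= T ->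
    `|a t - a r| <= Ca * `|t - r| * `|ln `|t - r| |) -> 1 <= L ->
  exists h dh : R -> R, forall t : R, 0 <= t <= T ->
  [/\ is_derive t 1 h (dh t), `|dh t| <= 2 * Ca * L,
      `|h t - a t| <= 2 * Ca * L * expR (- L) &
      exists2 x, 0 <= x <= T & h t = a x].
Proof.
move=> T0 C0 aC L1.
have [G [_ dG]] : exists F : R -> R, F 0 = 0 /\
    forall x : R, -1 < x -> is_derive x 1 F ((a \o clamp T) x).
  by apply: antiderivative; apply: log_lipschitz_continuous => //; exists Ca.
pose ep := expR (- L); have ep0 : 0 < ep by exact: expR_gt0.
exists (fun t => ep^-1 * (G (t + ep) - G t)),
  (fun t => ep^-1 * (a (clamp T (t + ep)) - a (clamp T t))).
move=> t tT; have /andP[t0 _] := tT.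
have d1 : is_derive t 1 (fun s : R => G (s + ep)) (a (clamp T (t + ep))).
  have dGe : is_derive (t + ep) 1 G (a (clamp T (t + ep))) by apply: dG; lra.
  have ds : is_derive t 1 (fun s : R => s + ep) 1.
    by apply: is_derive_eq; rewrite addr0.
  apply: is_derive_eq (@is_derive1_comp R G (fun s : R => s + ep) t _ _ dGe ds) _.
  by rewrite /GRing.scale /= ?mul1r ?mulr1.
have d2 : is_derive t 1 G (a (clamp T t)) by apply: dG; lra.
have CL t' s : `|t' - s| <= ep -> `|a (clamp T t') - a (clamp T s)| <= 2 * Ca * L * ep.
  move=> /(log_lipschitz_clamp T0 aC C0 L1)/le_trans; apply.
  by rewrite le_eqVlt; apply/orP; left; apply/eqP; rewrite /ep; ring.
have [x] : exists2 x, x \in `]t, (t + ep)[ &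
    G (t + ep) - G t = (a \o clamp T) x * (t + ep - t).
  apply: MVT; first by rewrite ltrDl.
    by move=> x; rewrite in_itv /= => /andP[tx _]; apply: dG; lra.
  apply: (is_derive_within_continuous (df := a \o clamp T)) => x /andP[tx _].
  by apply: dG; lra.
rewrite in_itv /= => /andP[tx xt] GE.
have {}GE : ep^-1 * (G (t + ep) - G t) = a (clamp T x).
  by rewrite GE /= addrAC subrr add0r mulrC mulfK// gt_eqF.
split.
- by apply: is_derive_eq; rewrite /GRing.scale /=; ring.
- rewrite normrM gtr0_norm ?invr_gt0// mulrC ler_pdivrMr//; apply: CL.
  by rewrite addrAC subrr add0r gtr0_norm.
- rewrite GE -[X in _ - a X](clamp_id tT); apply: CL.
  by rewrite gtr0_norm ?subr_gt0//; lra.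
- by exists (clamp T x) => //; rewrite clamp_itv// ltW.
Qed.

(** [f] solves [f'' + a b f = 0] with [f' = g]. Differentiability is only
    required inside the segment: this is what the coefficients of an arbitrary
    solution of the Cauchy problem satisfy, and it suffices for uniqueness. *)
Definition oscillation (T b : R) (a f g : R -> R) : Prop :=
  [/\ {within `[0, T], continuous f}, {within `[0, T], continuous g},
      forall t : R, t \in `]0, T[ -> is_derive t 1 f (g t) &
      forall t : R, t \in `]0, T[ -> is_derive t 1 g (- (a t * (b * f t)))].

(** The left side is the derivative of the energy [m^2 h f^2 + g^2]. The
    mollification error [h - a <= D * ep] comes with a factor [m], which
    [m * ep <= 1] absorbs; hence the rate [D], the size of [h'], for both terms. *)
Lemma energy_rate (m ep D al h a dh f g : R) :
  0 < m -> 0 <= ep -> m * ep <= 1 -> 0 < al -> al <= 1 -> al <= h ->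
  `|dh| <= D -> `|h - a| <= D * ep ->
  m ^+ 2 * dh * f ^+ 2 + 2 * m ^+ 2 * (h - a) * f * g <=
  2 * D / al * (m ^+ 2 * h * f ^+ 2 + g ^+ 2).
Proof.
move=> m0 ep0 mep al0 al1 alh dhD haD.
have D0 : 0 <= D by exact: le_trans dhD.
set N := m ^+ 2 * f ^+ 2 + g ^+ 2.
have f2 : 0 <= m ^+ 2 * f ^+ 2 by rewrite mulr_ge0// sqr_ge0.
have g2 : 0 <= g ^+ 2 by rewrite sqr_ge0.
have h1 : m ^+ 2 * dh * f ^+ 2 <= D * N.
  rewrite (@le_trans _ _ (D * (m ^+ 2 * f ^+ 2)))//; last first.
    by rewrite ler_wpM2l// lerDl.
  by rewrite mulrAC mulrC ler_wpM2r// (le_trans (ler_norm _)).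
have h2 : 2 * m ^+ 2 * (h - a) * f * g <= D * N.
  rewrite (le_trans (ler_norm _))// !normrM (gtr0_norm m0).
  rewrite (@ger0_norm _ 2)//.
  have sq : 2 * (m * `|f|) * `|g| <= N.
    have := sqr_ge0 (m * `|f| - `|g|).
    rewrite sqrrB exprMn !real_normK ?num_real// /N mulr2n; lra.
  apply: (@le_trans _ _ (D * (2 * (m * `|f|) * `|g|))); last by rewrite ler_wpM2l.
  have : m * `|h - a| <= D.
    rewrite (le_trans (ler_wpM2l (ltW m0) haD))// mulrCA.
    by rewrite -[leRHS]mulr1 ler_wpM2l.
  have : 0 <= 2 * (m * `|f|) * `|g| by rewrite !mulr_ge0// ltW.
  move=> P0 /(ler_wpM2r P0)/(le_trans _); apply.
  by rewrite le_eqVlt; apply/orP; left; apply/eqP; ring.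
have h3 : N <= (m ^+ 2 * h * f ^+ 2 + g ^+ 2) / al.
  rewrite ler_pdivlMr// mulrDl lerD//.
    by rewrite [leRHS]mulrAC ler_wpM2l.
  by rewrite -[leRHS]mulr1 ler_wpM2l.
have := ler_wpM2l D0 h3.
rewrite [X in _ <= X -> _](_ : _ = D / al * (m ^+ 2 * h * f ^+ 2 + g ^+ 2)).
  by rewrite -!mulrA -/N; lra.
by ring.
Qed.

(** The energy uses the mollified coefficient at scale [expR (- L)], which has to
    be at most the inverse of the frequency [m]. *)
Lemma energy_growth (T Ca A a0 L m : R) (a f g : R -> R) : 0 < T -> 0 < Ca ->
  (forall t r : R, 0 <= t <= T -> 0 <= r <= T ->
    `|a t - a r| <= Ca * `|t - r| * `|ln `|t - r| |) ->
  0 < a0 <= 1 -> (forall t, 0 <= t <= T -> a0 <= a t) ->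
  1 <= A -> (forall t, 0 <= t <= T -> a t <= A) ->
  1 <= L -> 0 < m -> m * expR (- L) <= 1 ->
  oscillation T (m ^+ 2) a f g ->
  forall t, 0 <= t <= T ->
  m ^+ 2 * f t ^+ 2 + g t ^+ 2 <=
  A / a0 * expR (4 * Ca / a0 * L * T) * (m ^+ 2 * f 0 ^+ 2 + g 0 ^+ 2).
Proof.
move=> T0 C0 aC /andP[a00 a01] aa0 A1 aA L1 m0 mL [cf cg df dg].
have [h [dh hP]] := log_lipschitz_mollify T0 C0 aC L1.
pose D := 2 * Ca * L.
have D0 : 0 <= D by rewrite /D !mulr_ge0//; lra.
pose E t := m ^+ 2 * h t * f t ^+ 2 + g t ^+ 2.
pose dE t := m ^+ 2 * dh t * f t ^+ 2 + 2 * m ^+ 2 * (h t - a t) * f t * g t.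
have oc (t : R) : t \in `]0, T[ -> 0 <= t <= T.
  by rewrite in_itv /= => /andP[? ?]; rewrite !ltW.
have ch : {within `[0, T], continuous h}.
  by apply: (is_derive_within_continuous (df := dh)) => x /hP[].
have cE : {within `[0, T], continuous E}.
  rewrite (_ : E = (fun t => m ^+ 2 * (h t * (f t * f t)))
      + (fun t => g t * g t)); last first.
    by apply/funext => t; rewrite /E !fctE !expr2; ring.
  apply: within_continuousD; do ?apply: within_continuousM => //;
    apply: continuous_subspaceT; exact: cst_continuous.
have dEP (t : R) : t \in `]0, T[ -> is_derive t 1 E (dE t).
  move=> tT; have dft := df t tT; have dgt := dg t tT.
  have [dht _ _ _] := hP t (oc t tT).
  apply: is_derive_eq; rewrite /GRing.scale /= /dE; ring.
have dEE t : t \in `]0, T[ -> dE t <= 2 * D / a0 * E t.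
  move=> /oc sT; have [_ h1 h2 [x xT hx]] := hP t sT.
  by apply: energy_rate m0 (expR_ge0 _) mL a00 a01 _ h1 h2; rewrite hx aa0.
move=> t tT; have /andP[t0 tT'] := tT.
have Egrow := @gronwall R E dE T (2 * D / a0) cE dEP dEE t tT.
have E0 : E 0 <= A * (m ^+ 2 * f 0 ^+ 2 + g 0 ^+ 2).
  have [|_ _ _ [x xT]] := hP 0; first by rewrite lexx ltW.
  rewrite /E => ->.
  rewrite mulrDr lerD//; last by rewrite ler_peMl// sqr_ge0.
  by rewrite [leRHS]mulrCA -mulrA ler_wpM2l ?sqr_ge0// ler_wpM2r ?sqr_ge0// aA.
have Et : a0 * (m ^+ 2 * f t ^+ 2 + g t ^+ 2) <= E t.
  have [_ _ _ [x xT]] := hP t tT; rewrite /E => ->.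
  rewrite mulrDr lerD//; last by rewrite ler_piMl// sqr_ge0.
  by rewrite mulrCA -[leRHS]mulrA ler_wpM2l ?sqr_ge0// ler_wpM2r ?sqr_ge0// aa0.
have EL : expR (2 * D / a0 * t) <= expR (4 * Ca / a0 * L * T).
  rewrite ler_expR (_ : 4 * Ca / a0 * L * T = 2 * D / a0 * T); last by rewrite /D; ring.
  by apply: ler_wpM2l => //; apply: divr_ge0; [rewrite mulr_ge0|exact: ltW].
have -> : A / a0 * expR (4 * Ca / a0 * L * T) * (m ^+ 2 * f 0 ^+ 2 + g 0 ^+ 2) =
    a0^-1 * (A * (m ^+ 2 * f 0 ^+ 2 + g 0 ^+ 2) * expR (4 * Ca / a0 * L * T)).
  by ring.
rewrite ler_pdivlMl// (le_trans Et)// (le_trans Egrow)//.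
rewrite (le_trans (ler_wpM2r (expR_ge0 _) E0))// ler_wpM2l//.
apply: mulr_ge0; first lra.
by apply: addr_ge0; [apply: mulr_ge0|]; exact: sqr_ge0.
Qed.

End Energy.

Section Modes.
Variable R : realType.

(** The mollification scale is [1 / (m + e)] for the frequency [m = sqrt b]: it is
    below [1 / m], and its logarithm [L = ln (m + e)] is at least 1 even for
    small [m]. The growth factor [expR (K * T * L)] is then a power of [m + e],
    hence at most a constant times [m `^ (K * T) = b `^ (K / 2 * T)], as [m] is
    bounded below. *)
Lemma energy_estimate (T c a0 : R) (a : R -> R) : 0 < T -> 0 < c -> 0 < a0 ->
  log_lipschitz T a -> (forall t, 0 <= t <= T -> a0 < a t) ->
  exists C delta : R, [/\ 0 < C, 0 < delta &
    forall b, c <= b -> forall f g, oscillation T b a f g ->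
    forall t, 0 <= t <= T ->
    b * f t ^+ 2 + g t ^+ 2 <=
    C * b `^ (delta / 2 * T) * (b * f 0 ^+ 2 + g 0 ^+ 2)].
Proof.
move=> T0 c0 a00 aLL aa0.
have [A0 aA0] := log_lipschitz_bounded T0 aLL.
have [Ca C0 aC] := aLL.
pose A := Num.max 1 A0.
have A1 : 1 <= A by rewrite /A le_max lexx.
have aA t : 0 <= t <= T -> a t <= A.
  by move=> /aA0 h; rewrite /A le_max (le_trans (ler_norm _) h) orbT.
pose al := Num.min a0 1.
have al0 : 0 < al by rewrite /al lt_min a00 ltr01.
have al1 : 0 < al <= 1 by rewrite al0 /al ge_min lexx orbT.
have aal t : 0 <= t <= T -> al <= a t.
  by move=> /aa0/ltW h; rewrite /al ge_min h.
pose e1 := expR 1 : R; have e10 : 0 < e1 by exact: expR_gt0.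
pose ka := 1 + e1 / Num.sqrt c.
have sc : 0 < Num.sqrt c by rewrite sqrtr_gt0.
have ka0 : 0 < ka by rewrite /ka addr_gt0// divr_gt0.
pose K := 4 * Ca / al.
have K0 : 0 < K by rewrite /K divr_gt0// mulr_gt0.
exists (A / al * expR (K * T * ln ka)), K; split=> //.
  by rewrite mulr_gt0 ?expR_gt0// divr_gt0//; lra.
move=> b cb f g fg t tT.
have b0 : 0 < b by exact: lt_le_trans cb.
pose m := Num.sqrt b.
have m0 : 0 < m by rewrite sqrtr_gt0.
have mE : m ^+ 2 = b by rewrite sqr_sqrtr// ltW.
pose L := ln (m + e1).
have me0 : 0 < m + e1 by rewrite addr_gt0.
have L1 : 1 <= L.
  by rewrite /L -(expRK 1) ler_ln ?posrE// -/e1 lerDr ltW.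
have mL : m * expR (- L) <= 1.
  by rewrite expRN lnK ?posrE// ler_pdivrMr// mul1r lerDl ltW.
have := energy_growth T0 C0 aC al1 aal A1 aA L1 m0 mL.
rewrite mE => /(_ f g fg t tT) h; apply: le_trans h _.
apply: ler_wpM2r.
  by apply: addr_ge0; [apply: mulr_ge0; [exact: ltW|]|]; exact: sqr_ge0.
rewrite -[leRHS]mulrA; apply: ler_wpM2l; first by apply: divr_ge0; lra.
rewrite -/K (_ : b `^ _ = expR (K * T * ln m)); last first.
  rewrite -{1}(lnK b0) -expRM; congr expR.
  rewrite (_ : ln b = ln m *+ 2); last by rewrite -lnXn// mE.
  by rewrite mulr2n; field.
rewrite -expRD ler_expR mulrAC -mulrDr.
apply: ler_wpM2l; first by apply: mulr_ge0; exact: ltW.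
rewrite /L -lnM ?posrE// ler_ln ?posrE ?mulr_gt0//.
rewrite /ka mulrDl mul1r lerD2l mulrAC ler_pdivlMr// ler_wpM2l ?(ltW e10)//.
exact: ler_wsqrtr.
Qed.

Lemma oscillation_unique (T c a0 : R) (a : R -> R) : 0 < T -> 0 < c -> 0 < a0 ->
  log_lipschitz T a -> (forall t, 0 <= t <= T -> a0 < a t) ->
  forall b, c <= b -> forall f g, oscillation T b a f g -> f 0 = 0 -> g 0 = 0 ->
  forall t, 0 <= t <= T -> f t = 0 /\ g t = 0.
Proof.
move=> T0 c0 a00 aLL aa0 b cb f g fg f0 g0 t tT.
have [C [d [_ _ /(_ b cb f g fg t tT)]]] := energy_estimate T0 c0 a00 aLL aa0.
rewrite f0 g0 expr0n /= mulr0 addr0 mulr0 => h.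
have b0 : 0 < b by exact: lt_le_trans cb.
have f2 : 0 <= b * f t ^+ 2 by apply: mulr_ge0; [exact: ltW|exact: sqr_ge0].
have g2 : 0 <= g t ^+ 2 by exact: sqr_ge0.
split; apply/eqP.
  rewrite -[_ == _](@expf_eq0 _ _ 2) -(mulrI_eq0 _ (mulfI (lt0r_neq0 b0))).
  by rewrite eq_le f2 andbT; lra.
by rewrite -[_ == _](@expf_eq0 _ _ 2) eq_le g2 andbT; lra.
Qed.

(** Here, in contrast with [oscillation], the functions are defined beyond the
    segment and have two-sided derivatives up to its endpoints. *)
Definition two_sided_oscillation (T b : R) (a f g : R -> R) :=
  forall t : R, 0 <= t <= T ->
  is_derive t 1 f (g t) /\ is_derive t 1 g (- (a t * (b * f t))).

Lemma two_sided_oscillation_exists (T b : R) (a : R -> R) (x0 y0 : R) : 0 < T ->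
  log_lipschitz T a ->
  exists f g, [/\ f 0 = x0, g 0 = y0 & two_sided_oscillation T b a f g].
Proof.
move=> T0 aLL; have [A aA] := log_lipschitz_bounded T0 aLL.
have [||f [g [f0 g0 fg]]] := @oscillator_exists R T (A * `|b|)
  (fun t => (a \o clamp T) t * b) x0 y0 (ltW T0).
- move=> t; apply: continuousM; last exact: cst_continuous.
  exact: log_lipschitz_continuous.
- by move=> t tT; rewrite /= clamp_id// normrM ler_wpM2r// aA.
exists f, g; split=> // t tT; have [d1 d2] := fg t tT; split=> //.
by apply: is_derive_eq; rewrite /= clamp_id// mulrA.
Qed.

Lemma two_sided_oscillationW (T b : R) (a f g : R -> R) :
  two_sided_oscillation T b a f g -> oscillation T b a f g.
Proof.
move=> fg; split.
- by apply: (is_derive_within_continuous (df := g)) => t /fg[].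
- by apply: (is_derive_within_continuous (df := fun t => - (a t * (b * f t)))) => t /fg[].
- by move=> t; rewrite in_itv /= => /andP[t0 tT]; apply: (fg t _).1; rewrite !ltW.
- by move=> t; rewrite in_itv /= => /andP[t0 tT]; apply: (fg t _).2; rewrite !ltW.
Qed.

End Modes.

(** * Difference quotients *)

Section Quotients.
Variable R : realType.

Lemma is_derive_quotient (f : R -> R) (t df : R) : is_derive t 1 f df ->
  h^-1 * (f (t + h) - f t) @[h --> 0^'] --> df.
Proof.
move=> [fd <-].
rewrite (_ : (fun h : R => h^-1 * (f (t + h) - f t)) =
  (fun h => h^-1 *: ((f \o shift t) (h *: 1) - f t)))//.
by apply/funext => h; rewrite /= (addrC t) [h *: _]mulr1.
Qed.

Lemma difference_quotient_le (T M : R) (f df : R -> R) :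
  (forall t : R, 0 <= t <= T -> is_derive t 1 f (df t)) ->
  (forall t : R, 0 <= t <= T -> `|df t| <= M) ->
  forall t h : R, 0 <= t <= T -> 0 <= t + h <= T ->
  `|h^-1 * (f (t + h) - f t)| <= M.
Proof.
move=> fd dM t h tT thT.
have M0 : 0 <= M by apply: le_trans (dM t tT).
suff key x y : x < y -> 0 <= x <= T -> 0 <= y <= T ->
    `|f y - f x| <= M * (y - x).
  have [->|hn0] := eqVneq h 0; first by rewrite invr0 mul0r normr0.
  rewrite normrM normfV mulrC ler_pdivrMr ?normr_gt0//.
  have [h0|h0] := ltP 0 h.
    have := key t (t + h) _ tT thT; rewrite ltrDl h0 => /(_ isT).
    by rewrite addrAC subrr add0r (gtr0_norm h0).
  have h0' : h < 0 by rewrite lt_neqAle hn0 h0.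
  have := key (t + h) t _ thT tT; rewrite gtrDl h0' => /(_ isT).
  by rewrite distrC opprD addrA subrr add0r (ltr0_norm h0').
move=> xy /andP[x0 xT] /andP[y0 yT].
have [||z] := @MVT R f df x y xy.
- move=> z; rewrite in_itv /= => /andP[xz zy]; apply: fd.
  by rewrite (le_trans x0 (ltW xz)) (le_trans (ltW zy) yT).
- apply: (is_derive_within_continuous (df := df)) => z /andP[xz zy].
  by apply: fd; rewrite (le_trans x0 xz) (le_trans zy yT).
rewrite in_itv /= => /andP[xz zy] ->.
have yx : 0 <= y - x by rewrite subr_ge0 ltW.
rewrite normrM (ger0_norm yx) ler_wpM2r//.
by apply: dM; rewrite (le_trans x0 (ltW xz)) (le_trans (ltW zy) yT).
Qed.

Lemma within_quotientP (T t l : R) (q : R -> R) :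
  q h @[h --> within [set h | 0 <= t + h <= T] 0^'] --> l ->
  forall e, 0 < e -> exists2 d : R, 0 < d & forall h, `|h| < d -> h != 0 ->
    0 <= t + h <= T -> `|l - q h| <= e.
Proof.
have FF : Filter (within [set h : R | 0 <= t + h <= T] 0^').
  exact: within_filter.
move=> ql e e0; have := (cvgrPdist_le _ _).1 ql e e0.
rewrite !near_withinE => -[d /= d0 dP]; exists d => // h hd.
by apply: dP; rewrite /= sub0r normrN.
Qed.

(** At the endpoints the difference quotient is one-sided, so only continuity
    survives there; inside, it is the usual derivative. *)
Lemma quotient_within_continuous (T : R) (f df : R -> R) : 0 < T ->
  (forall t : R, 0 <= t <= T ->
    h^-1 * (f (t + h) - f t) @[h --> within [set h | 0 <= t + h <= T] 0^']
      --> df t) ->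
  {within `[0, T], continuous f} /\
  forall t : R, t \in `]0, T[ -> is_derive t 1 f (df t).
Proof.
move=> T0 fd.
have loc (t e : R) : 0 <= t <= T -> 0 < e -> exists2 d : R, 0 < d &
    forall r, `|t - r| < d -> 0 <= r <= T -> `|f t - f r| <= e.
  move=> tT e0; have [d d0 dP] := within_quotientP (fd t tT) ltr01.
  pose N := `|df t| + 1; have N0 : 0 < N by rewrite ltr_wpDl.
  exists (Num.min d (e / N)); first by rewrite lt_min d0 divr_gt0.
  move=> r; rewrite lt_min => /andP[rd re] rT.
  have [->|rt] := eqVneq r t; first by rewrite subrr normr0 ltW.
  have := dP (r - t); rewrite distrC => /(_ rd).
  rewrite subr_eq0 (addrC t) subrK => /(_ rt rT) h.
  have q : `|(r - t)^-1 * (f r - f t)| <= N.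
    rewrite -[X in `|X|](subKr (df t)) (le_trans (ler_normB _ _))//.
    by rewrite /N lerD2l.
  move: q; rewrite normrM normfV mulrC ler_pdivrMr ?normr_gt0 ?subr_eq0//.
  rewrite distrC => /le_trans; apply.
  by rewrite mulrC -ler_pdivlMr// distrC ltW.
have der (t : R) : t \in `]0, T[ -> is_derive t 1 f (df t).
  rewrite in_itv /= => /andP[t0 tT].
  have tT' : 0 <= t <= T by rewrite !ltW.
  have dcvg : h^-1 *: ((f \o shift t) (h *: 1) - f t) @[h --> 0^'] --> df t.
    rewrite (_ : (fun h : R => _) = (fun h : R => h^-1 * (f (t + h) - f t))); last first.
      by apply/funext => h; rewrite /= (addrC t) [h *: _]mulr1.
    apply/cvgrPdist_le => e e0.
    have [d d0 dP] := within_quotientP (fd t tT') e0.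
    pose d' := Num.min d (Num.min t (T - t)).
    have d'0 : 0 < d' by rewrite !lt_min d0 t0 subr_gt0.
    rewrite near_withinE; exists d' => // h; rewrite /= sub0r normrN !lt_min.
    move=> /and3P[hd ht hT] hn0; apply: dP => //.
    by move: ht hT; rewrite !ltr_norml => /andP[? ?] /andP[? ?]; apply/andP; split; lra.
  by apply: DeriveDef; [exact: cvgP dcvg|exact: cvg_lim dcvg].
split=> //.
apply/subspace_continuousP => t; rewrite /= in_itv /= => tT.
apply/cvgrPdist_le => e e0; rewrite near_withinE.
have [d d0 dP] := loc t e tT e0.
by exists d => //= r tr; rewrite in_itv /=; exact: dP.
Qed.

End Quotients.

(** * Real and complex scalars *)

Section Scalars.
Variables (R : realType) (k : scalar_kind).
Implicit Types (x y : scalarField R k) (a b : R).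

Lemma normS x : `|x| = ofR k (absS x).
Proof. by case: k x => //= x; rewrite normc_def. Qed.

Lemma ofR_le a b : (ofR k a <= ofR k b) = (a <= b).
Proof. by case: k => //=; rewrite lecR. Qed.

Lemma ofR_lt a b : (ofR k a < ofR k b) = (a < b).
Proof. by case: k => //=; rewrite ltcR. Qed.

Lemma ofR_inj : injective (@ofR R k).
Proof. by case: k => //=; exact: complexI. Qed.

Lemma ofR0 : ofR k 0 = 0 :> scalarField R k.
Proof. by case: k. Qed.

Lemma ofR1 : ofR k 1 = 1 :> scalarField R k.
Proof. by case: k. Qed.

Lemma ofRM a b : ofR k (a * b) = ofR k a * ofR k b.
Proof. by case: k => //=; rewrite rmorphM. Qed.

Lemma ofRD a b : ofR k (a + b) = ofR k a + ofR k b.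
Proof. by case: k => //=; rewrite rmorphD. Qed.

Lemma ofRN a : ofR k (- a) = - ofR k a.
Proof. by case: k => //=; rewrite rmorphN. Qed.

Lemma ofR_sum (I : Type) (r : seq I) (P : pred I) (f : I -> R) :
  ofR k (\sum_(i <- r | P i) f i) = \sum_(i <- r | P i) ofR k (f i).
Proof. exact: (big_morph _ ofRD ofR0). Qed.

Lemma absS_ge0 x : 0 <= absS x.
Proof. by rewrite -ofR_le -normS ofR0. Qed.

Lemma absSD x y : absS (x + y) <= absS x + absS y.
Proof. by rewrite -ofR_le ofRD -!normS ler_normD. Qed.

Lemma absSM x y : absS (x * y) = absS x * absS y.
Proof. by apply: ofR_inj; rewrite ofRM -!normS normrM. Qed.

Lemma absS_ofR a : absS (ofR k a) = `|a|.
Proof. by case: k => //; rewrite /absS /ofR normc_def /= expr0n /= addr0 sqrtr_sqr. Qed.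

Lemma absS_comb_le a b x y :
  absS (ofR k a * x + ofR k b * y) ^+ 2 <=
  2 * (a ^+ 2 * absS x ^+ 2 + b ^+ 2 * absS y ^+ 2).
Proof.
have h : absS (ofR k a * x + ofR k b * y) <= `|a| * absS x + `|b| * absS y.
  by rewrite (le_trans (absSD _ _))// !absSM !absS_ofR.
rewrite (@le_trans _ _ ((`|a| * absS x + `|b| * absS y) ^+ 2))//.
  by rewrite ler_pXn2r// nnegrE ?absS_ge0// addr_ge0// mulr_ge0// absS_ge0.
rewrite -(real_normK (num_real a)) -(real_normK (num_real b)) -!exprMn.
have := sqr_ge0 (`|a| * absS x - `|b| * absS y).
rewrite sqrrB sqrrD !mulr2n; lra.
Qed.

(** The two real coordinates of a scalar. For real scalars the second one is 0,
    so that both kinds of scalars are compared coordinate by coordinate. *)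
Definition partS (i : bool) : scalarField R k -> R :=
  match k with
  | RealScalars => fun x : R => if i then x else 0
  | ComplexScalars => fun z : R[i] => if i then complex.Re z else complex.Im z
  end.

Lemma partSB i x y : partS i (x - y) = partS i x - partS i y.
Proof.
by rewrite /partS; case: k x y => x y; case: i => //=; rewrite ?subrr//;
  rewrite raddfB.
Qed.

Lemma partSN i x : partS i (- x) = - partS i x.
Proof.
by rewrite /partS; case: k x => x; case: i => //=; rewrite ?oppr0//; case: x.
Qed.

Lemma partS_ofRM i a x : partS i (ofR k a * x) = a * partS i x.
Proof.
rewrite /partS; case: k x => x; case: i => //=; rewrite ?mulr0//;
  by case: x => u v /=; ring.
Qed.

Lemma partS_le i x : `|partS i x| <= absS x.
Proof.
rewrite /partS /absS; case: k x => x; case: i; rewrite ?normr0// normc_def /=.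
  by rewrite -sqrtr_sqr ler_wsqrtr// lerDl sqr_ge0.
by rewrite -sqrtr_sqr ler_wsqrtr// lerDr sqr_ge0.
Qed.

Lemma partS_inj x y : (forall i, partS i x = partS i y) -> x = y.
Proof.
rewrite /partS; case: k x y => x y h; first exact: (h true).
by case: x y h => u v [u' v'] h; rewrite (h true : u = u') (h false : v = v').
Qed.

End Scalars.

(** * Series in the Sobolev norms *)

Section DominatedSeries.
Variable R : realType.

(** A tail of the majorant is small uniformly in [h]; the remaining finite sum
    tends to 0 term by term. *)
Lemma dominated_series_cvg0 (U : Type) (F : set_system U) (FF : Filter F)
    (g : U -> nat -> R) (M : nat -> R) :
  (forall h j, 0 <= g h j) -> (\forall h \near F, forall j, g h j <= M j) ->
  (\sum_(j <oo) (M j)%:E < +oo)%E ->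
  (forall j, g h j @[h --> F] --> 0) ->
  (\sum_(j <oo) (g h j)%:E)%E @[h --> F] --> 0%E.
Proof.
move=> g0 gM Moo gcvg.
(* If [F] is improper, every limit holds and no majorant can be inspected. *)
have [F0|Fn0] := pselect (F set0).
  by move=> A _; apply: (@filterS _ F _ set0).
have PF : ProperFilter F by split.
have M0 j : 0 <= M j.
  have [h gh] := filter_ex gM.
  by rewrite (le_trans (g0 h j)).
have tail := nneseries_tail_cvg Moo (fun j _ => M0 j : (0 <= (M j)%:E)%E).
have key e : 0 < e -> \forall h \near F, (\sum_(j <oo) (g h j)%:E <= e%:E)%E.
  move=> e0; have e20 : 0 < e / 2 by rewrite divr_gt0.
  have [tfin /cvgrPdist_le/(_ _ e20)] := (fine_cvgP _ _).1 tail.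
  move=> tsmall; have [N [Nfin Nsmall]] : exists N : nat,
      (\sum_(N <= k <oo) (M k)%:E)%E \is a fin_num /\
      `|0 - fine (\sum_(N <= k <oo) (M k)%:E)%E| <= e / 2.
    exact: filter_ex (filterI tfin tsmall).
  have head : \sum_(0 <= j < N) g h j @[h --> F] --> (0 : R).
    rewrite -[X in _ --> X](@big1 R 0 +%R nat (index_iota 0 N) xpredT (fun=> 0))//.
    by apply: cvg_big => // ; exact: add_continuous.
  have {}head := (cvgrPdist_le _ _).1 head _ e20.
  near=> h.
  rewrite (@nneseries_split _ _ 0%N N) ?add0n; last by move=> j _; rewrite lee_fin.
  rewrite (_ : e = e / 2 + e / 2); last by field.
  rewrite EFinD leeD//.
    rewrite sumEFin lee_fin.
    have : `|0 - \sum_(0 <= j < N) g h j| <= e / 2.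
      by near: h; exact: head.
    by rewrite sub0r normrN; apply: le_trans (ler_norm _).
  have ghM : forall j, g h j <= M j by near: h; exact: gM.
  apply: (@le_trans _ _ (\sum_(N <= j <oo) (M j)%:E)%E).
    by apply: lee_nneseries => j *; rewrite lee_fin.
  rewrite -(fineK Nfin) lee_fin.
  by move: Nsmall; rewrite sub0r normrN; apply: le_trans (ler_norm _).
have S0 h : (0 <= \sum_(j <oo) (g h j)%:E)%E.
  by apply: nneseries_ge0 => j _ _; rewrite lee_fin.
apply/fine_cvgP; split.
  near=> h; rewrite fin_numElt (lt_le_trans _ (S0 h)) ?ltNyr//=.
  have : (\sum_(j <oo) (g h j)%:E <= 1%:E)%E by near: h; exact: key.
  by move/le_lt_trans; apply; rewrite ltry.
apply/cvgrPdist_le => e e0; near=> h.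
have Se : (\sum_(j <oo) (g h j)%:E <= e%:E)%E by near: h; exact: key.
rewrite sub0r normrN /= ger0_norm ?fine_ge0//.
rewrite -lee_fin fineK// fin_numElt (lt_le_trans _ (S0 h)) ?ltNyr//=.
by rewrite (le_lt_trans Se)// ltry.
Unshelve. all: end_near. Qed.

End DominatedSeries.

Section RieszFischer.
Variables (R : realType) (k : scalar_kind).
Variables (H : completeNormedModType (scalarField R k)).
Variables (dot : {dot H for @conjS R k}) (hdot : norm_from_dot dot).
Variables (e : nat -> H) (eON : forall i j, dot (e i) (e j) = (i == j)%:R).
Implicit Type w : nat -> scalarField R k.

Lemma dot_sum_basis w m n i : (m <= i < n)%N ->
  dot (\sum_(m <= j < n) w j *: e j) (e i) = w i.
Proof.
move=> /andP[mi iN].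
rewrite linear_sumlz (bigD1_seq i) ?iota_uniq ?mem_index_iota ?mi//=.
rewrite big1 ?addr0 => [|j ji].
all: by rewrite linearZl_LR /= eON ?eqxx ?(negbTE ji) ?mulr1 ?mulr0.
Qed.

Lemma sqnorm_sum_basis w m n :
  `|\sum_(m <= j < n) w j *: e j| ^+ 2 =
  ofR k (\sum_(m <= j < n) absS (w j) ^+ 2).
Proof.
rewrite hdot ofR_sum; set S := \sum_(m <= j < n) w j *: e j.
rewrite {1}/S linear_sumlz !big_nat; apply: eq_bigr => i imn.
rewrite linearZl_LR /= (hermitian_subproof (e i) S) /= mul1r dot_sum_basis//.
by rewrite conjS_norm normS !expr2 ofRM.
Qed.

(** By orthonormality the partial sums of [w j *: e j] are Cauchy as soon as those
    of the squared coefficients are; the limit exists by completeness. *)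
Lemma riesz_fischer w : (\sum_(j <oo) (absS (w j) ^+ 2)%:E < +oo)%E ->
  exists u : H, w = fourier dot e u.
Proof.
move=> woo.
have tail := nneseries_tail_cvg woo
  (fun j _ => sqr_ge0 (absS (w j)) : (0 <= (absS (w j) ^+ 2)%:E)%E).
have cw : cvgn (series (fun j => w j *: e j)).
  apply: cauchy_cvg; apply/cauchy_seriesP => ep ep0.
  (* A positive element of the scalar field is the image of a positive real. *)
  pose r := absS ep.
  have epE : ep = ofR k r by rewrite -normS gtr0_norm.
  have r0 : 0 < r by rewrite -(ofR_lt k) ofR0 -epE.
  have r20 : 0 < r ^+ 2 by rewrite exprn_gt0.
  have [[N1 _ tfin] /cvgrPdist_lt/(_ _ r20)[N2 _ tsmall]] := (fine_cvgP _ _).1 tail.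
  pose N := maxn N1 N2.
  have Nfin := tfin N (leq_maxl _ _).
  have Nsmall := tsmall N (leq_maxr _ _).
  exists ([set n | (N <= n)%N], [set n | (N <= n)%N]).
    by split; exists N.
  move=> [m n] /= [Nm Nn].
  rewrite -(@ltr_pXn2r _ 2) ?nnegrE ?(ltW ep0)//.
  rewrite sqnorm_sum_basis epE expr2 -ofRM ofR_lt -expr2.
  apply: le_lt_trans Nsmall; rewrite sub0r normrN /=.
  apply: le_trans (ler_norm _); rewrite -lee_fin fineK//.
  rewrite (le_trans _ (nneseries_lim_ge n _))//; last first.
    by move=> j _ _; rewrite lee_fin sqr_ge0.
  rewrite sumEFin lee_fin.
  have [mn|nm] := leqP m n.
    by rewrite [leRHS](big_cat_nat Nm mn) /= lerDr sumr_ge0// => j _; exact: sqr_ge0.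
  by rewrite big_geq ?(ltnW nm)// sumr_ge0// => j _; exact: sqr_ge0.
exists (limn (series (fun j => w j *: e j))); apply/funext => m; apply/eqP.
rewrite eq_sym -subr_eq0 -normr_le0; apply/ler_addgt0Pr => ep ep0; rewrite add0r.
have /cvgrPdist_le /(_ _ ep0) [n _ hn] := cw.
have {hn} := hn (maxn n m.+1) (leq_maxl _ _).
apply: le_trans; rewrite /fourier -[w m](@dot_sum_basis w 0 (maxn n m.+1)) ?leq_maxr//.
by rewrite -linearBl; apply: bessel1 => //; rewrite eON eqxx.
Qed.

(** For [0 <= s] the weights are bounded below by [c `^ s], so a finite norm of
    order [s] forces square summability, hence an element of [H]. *)
Lemma sobolev_finite (lam : nat -> R) (c s : R) w : 0 < c ->
  (forall j, c <= lam j ^+ 2) -> (sobolev_sqnorm lam s w < +oo)%E ->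
  sobolev lam dot e s w.
Proof.
move=> c0 lamc woo; split=> // s0; apply: riesz_fischer.
have cs : 0 < c `^ s by exact: powR_gt0.
apply: (@le_lt_trans _ _ ((c `^ s)^-1%:E * sobolev_sqnorm lam s w)%E); last first.
  by rewrite lte_mul_pinfty// lee_fin invr_ge0 ltW.
rewrite /sobolev_sqnorm -nneseriesZl; last first.
  by move=> j _; rewrite lee_fin mulr_ge0 ?powR_ge0 ?sqr_ge0.
apply: lee_nneseries => [j _ _|j _]; first by rewrite lee_fin sqr_ge0.
rewrite -EFinM lee_fin mulrA ler_peMl ?sqr_ge0//.
by rewrite ler_pdivlMl// mulr1 ge0_ler_powR ?nnegrE ?sqr_ge0// ltW.
Qed.

End RieszFischer.

Section Termwise.
Variables (R : realType) (k : scalar_kind) (lam : nat -> R) (T : R).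
Implicit Types x y : nat -> scalarField R k.

(** The bounds [al] and [be] on the derivatives bound the difference quotients as
    well, by the mean value theorem. The series of squared errors is therefore
    dominated uniformly in the increment, with termwise limit 0. *)
Lemma sobolev_derivative_series (r : R) (f f' g g' : nat -> R -> R)
    (al be : nat -> R) x y :
  (forall j (t : R), 0 <= t <= T -> is_derive t 1 (f j) (f' j t)) ->
  (forall j (t : R), 0 <= t <= T -> is_derive t 1 (g j) (g' j t)) ->
  (forall j t, 0 <= t <= T -> f' j t ^+ 2 <= al j) ->
  (forall j t, 0 <= t <= T -> g' j t ^+ 2 <= be j) ->
  (\sum_(j <oo) ((lam j ^+ 2) `^ r *
    (al j * absS (x j) ^+ 2 + be j * absS (y j) ^+ 2))%:E < +oo)%E ->
  sobolev_derivative lam T r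
    (fun t j => ofR k (f j t) * x j + ofR k (g j t) * y j)
    (fun t j => ofR k (f' j t) * x j + ofR k (g' j t) * y j).
Proof.
move=> fd gd fal gbe Moo t tT; rewrite /sobolev_sqnorm.
pose q (F : R -> R) h := h^-1 * (F (t + h) - F t).
have FF : Filter (within [set h : R | 0 <= t + h <= T] 0^') by exact: within_filter.
have termE h j : ofR k h^-1 * (ofR k (f j (t + h)) * x j + ofR k (g j (t + h)) * y j
      - (ofR k (f j t) * x j + ofR k (g j t) * y j))
      - (ofR k (f' j t) * x j + ofR k (g' j t) * y j) =
    ofR k (q (f j) h - f' j t) * x j + ofR k (q (g j) h - g' j t) * y j.
  by rewrite /q !ofRD !ofRM !ofRD !ofRN; ring.
have qb (F F' : R -> R) m h : (forall s : R, 0 <= s <= T -> is_derive s 1 F (F' s)) ->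
    (forall s, 0 <= s <= T -> F' s ^+ 2 <= m) -> 0 <= t + h <= T ->
    (q F h - F' t) ^+ 2 <= 4 * m.
  move=> dF F'm thT.
  have m0 : 0 <= m by apply: le_trans (F'm t tT); exact: sqr_ge0.
  have F'b s : 0 <= s <= T -> `|F' s| <= Num.sqrt m.
    by move=> sT; rewrite -sqrtr_sqr ler_wsqrtr// F'm.
  have h1 := difference_quotient_le dF F'b tT thT.
  have h2 : `|q F h - F' t| <= 2 * Num.sqrt m.
    by have := F'b t tT; have := ler_normB (q F h) (F' t); rewrite /q; lra.
  rewrite -real_normK ?num_real// -(sqr_sqrtr m0).
  rewrite (_ : 4 * _ = (2 * Num.sqrt m) ^+ 2); last by ring.
  by rewrite ler_pXn2r// nnegrE mulr_ge0.
have qcvg (F : R -> R) (F't : R) : is_derive t 1 F F't ->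
    (q F h - F't) ^+ 2 @[h --> within [set h : R | 0 <= t + h <= T] 0^'] --> 0.
  move=> dF; have : q F h - F't @[h --> within [set h : R | 0 <= t + h <= T] 0^'] --> 0.
    rewrite -[X in _ --> X](subrr F't).
    have qF : q F h @[h --> within [set h : R | 0 <= t + h <= T] 0^'] --> F't.
      exact: cvg_within_filter (is_derive_quotient dF).
    by apply: (cvgB qF); exact: cvg_cst.
  move=> h; rewrite -[X in _ --> X](mulr0 0); under eq_cvg do rewrite expr2.
  exact: cvgM.
apply: (@dominated_series_cvg0 _ _ _ _ _ (fun j => 8 * ((lam j ^+ 2) `^ r *
    (al j * absS (x j) ^+ 2 + be j * absS (y j) ^+ 2)))).
- by move=> h j; rewrite mulr_ge0 ?powR_ge0 ?sqr_ge0.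
- rewrite near_withinE; apply: nearW => h thT j.
  rewrite termE [leRHS]mulrCA ler_wpM2l ?powR_ge0// (le_trans (absS_comb_le _ _ _ _))//.
  have := ler_wpM2r (sqr_ge0 (absS (x j))) (qb _ _ _ h (fd j) (fal j) thT).
  have := ler_wpM2r (sqr_ge0 (absS (y j))) (qb _ _ _ h (gd j) (gbe j) thT).
  lra.
- under eq_eseriesr do rewrite EFinM.
  rewrite nneseriesZl ?lte_mul_pinfty// ?lee_fin// => j _.
  rewrite lee_fin mulr_ge0 ?powR_ge0// addr_ge0// mulr_ge0 ?sqr_ge0//.
    by rewrite (le_trans (sqr_ge0 _) (fal j t tT)).
  by rewrite (le_trans (sqr_ge0 _) (gbe j t tT)).
- move=> j; under eq_cvg do rewrite termE.
  pose B h := (lam j ^+ 2) `^ r * (2 * ((q (f j) h - f' j t) ^+ 2 * absS (x j) ^+ 2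
     + (q (g j) h - g' j t) ^+ 2 * absS (y j) ^+ 2)).
  apply: (@squeeze_cvgr _ _ _ _ (cst 0) B).
  + apply: nearW => h; rewrite mulr_ge0 ?powR_ge0 ?sqr_ge0//=.
    by rewrite ler_wpM2l ?powR_ge0// absS_comb_le.
  + exact: cvg_cst.
  + have z : (lam j ^+ 2) `^ r * (2 * (0 * absS (x j) ^+ 2 + 0 * absS (y j) ^+ 2)) = 0.
      by ring.
    rewrite -[X in _ --> X]z.
    apply: cvgM; first exact: cvg_cst.
    apply: cvgM; first exact: cvg_cst.
    apply: cvgD; apply: cvgM; try exact: cvg_cst.
      by apply: qcvg; exact: fd.
    by apply: qcvg; exact: gd.
Qed.

(** A single term of the series defining the norm is at most the norm, and its
    weight is positive: convergence in any Sobolev norm, of whatever order,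
    implies convergence of each coefficient. *)
Lemma sobolev_derivative_part (r : R) (u du : R -> nat -> scalarField R k) j i :
  0 < lam j ^+ 2 -> sobolev_derivative lam T r u du ->
  forall t : R, 0 <= t <= T ->
    h^-1 * (partS i (u (t + h) j) - partS i (u t j))
      @[h --> within [set h | 0 <= t + h <= T] 0^'] --> partS i (du t j).
Proof.
move=> lam0 ud t tT; have := ud t tT.
have FF : Filter (within [set h : R | 0 <= t + h <= T] 0^') by exact: within_filter.
move=> /fine_cvgP[Sfin S0].
apply/cvgrPdist_le => ep ep0.
pose W := (lam j ^+ 2) `^ r; have W0 : 0 < W by exact: powR_gt0.
have We0 : 0 < W * ep ^+ 2 by rewrite mulr_gt0// exprn_gt0.
have Ssmall := (cvgrPdist_le _ _).1 S0 _ We0.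
near=> h.
have hfin : sobolev_sqnorm lam r
      (fun j => ofR k h^-1 * (u (t + h) j - u t j) - du t j) \is a fin_num.
  by near: h; exact: Sfin.
have : `|0 - fine (sobolev_sqnorm lam r
      (fun j => ofR k h^-1 * (u (t + h) j - u t j) - du t j))| <= W * ep ^+ 2.
  by near: h; exact: Ssmall.
rewrite sub0r normrN => /(le_trans (ler_norm _)).
rewrite -lee_fin fineK// => Sle.
set z := ofR k h^-1 * (u (t + h) j - u t j) - du t j.
have : W * absS z ^+ 2 <= W * ep ^+ 2.
  rewrite -lee_fin (le_trans _ Sle)//.
  have g0 : forall n, xpredT n ->
     (0 <= ((lam n ^+ 2) `^ r *
       absS (ofR k h^-1 * (u (t + h) n - u t n) - du t n) ^+ 2)%:E)%E.
    by move=> n _; rewrite lee_fin mulr_ge0 ?powR_ge0 ?sqr_ge0.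
  rewrite /sobolev_sqnorm (@nneseriesD1 _ _ j)// leeDl// nneseries_ge0// => n _ _.
  exact: g0.
rewrite ler_pM2l// ler_pXn2r ?nnegrE ?absS_ge0 ?(ltW ep0)// => zep.
have := partS_le i z; rewrite partSB partS_ofRM partSB distrC.
by move/le_trans; exact.
Unshelve. all: end_near. Qed.

End Termwise.

(** * Uniqueness *)

Section Uniqueness.
Variables (R : realType) (k : scalar_kind).
Variables (H : completeNormedModType (scalarField R k)).
Variables (dot : {dot H for @conjS R k}) (e : nat -> H) (lam : nat -> R).
Variables (T : R) (T0 : 0 < T) (a : R -> R).

Lemma cauchy_solution_part (u0 u1 : nat -> scalarField R k) (r : R)
    (u du : R -> nat -> scalarField R k) j i :
  0 < lam j ^+ 2 -> cauchy_solution dot e lam T a u0 u1 r u du ->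
  oscillation T (lam j ^+ 2) a (fun t => partS i (u t j)) (fun t => partS i (du t j)).
Proof.
move=> lam0 [_ _ ud dud _ _].
have [c1 d1] := quotient_within_continuous T0 (sobolev_derivative_part (i := i) lam0 ud).
have [c2 d2] := quotient_within_continuous T0 (sobolev_derivative_part (i := i) lam0 dud).
split=> // t tT; have := d2 t tT.
by rewrite partSN partS_ofRM /extA partS_ofRM.
Qed.

(** The orders [r] and [r'] may differ: the coefficients of both solutions solve
    the same scalar problems, whose solutions are unique. *)
Lemma cauchy_solution_unique (c a0 : R) (u0 u1 : nat -> scalarField R k)
    (r r' : R) (u du v dv : R -> nat -> scalarField R k) :
  0 < c -> (forall j, c <= lam j ^+ 2) -> log_lipschitz T a -> 0 < a0 ->
  (forall t, 0 <= t <= T -> a0 < a t) ->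
  cauchy_solution dot e lam T a u0 u1 r u du ->
  cauchy_solution dot e lam T a u0 u1 r' v dv ->
  forall t, 0 <= t <= T -> v t = u t /\ dv t = du t.
Proof.
move=> c0 lamc aLL a00 aa0 us vs t tT.
suff key j i : partS i (v t j) = partS i (u t j) /\ partS i (dv t j) = partS i (du t j).
  by split; apply/funext => j; apply: partS_inj => i; have [] := key j i.
have lam0 : 0 < lam j ^+ 2 by exact: lt_le_trans (lamc j).
have [cu cdu du1 du2] := cauchy_solution_part i lam0 us.
have [cv cdv dv1 dv2] := cauchy_solution_part i lam0 vs.
have d : oscillation T (lam j ^+ 2) a
    ((fun t => partS i (v t j)) - (fun t => partS i (u t j)))
    ((fun t => partS i (dv t j)) - (fun t => partS i (du t j))).
  split; try exact: within_continuousB.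
    move=> s sT; have d1 := dv1 s sT; have d2 := du1 s sT.
    exact: is_deriveB.
  move=> s sT; have d1 := dv2 s sT; have d2 := du2 s sT.
  by apply: is_derive_eq; rewrite !fctE; ring.
have [] := oscillation_unique T0 c0 a00 aLL aa0 (lamc j) d _ _ tT.
- rewrite !fctE; case: us => _ _ _ _ -> _; case: vs => _ _ _ _ -> _.
  by rewrite subrr.
- rewrite !fctE; case: us => _ _ _ _ _ ->; case: vs => _ _ _ _ _ ->.
  by rewrite subrr.
by rewrite !fctE => /eqP; rewrite subr_eq0 => /eqP -> /eqP; rewrite subr_eq0 => /eqP ->.
Qed.

End Uniqueness.

(** * The Cauchy problem *)

Lemma powRB1 (R : realType) (b r : R) : 0 < b -> b `^ (r - 1) * b = b `^ r.
Proof.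
move=> b0; rewrite -[X in _ * X](powRr1 (ltW b0)) -powRD ?subrK//.
by rewrite (gt_eqF b0) implybT.
Qed.

Lemma nneseries_le_lty (R : realType) (f g : nat -> R) (K : R) : (forall j, 0 <= f j) ->
  (forall j, 0 <= g j) -> (forall j, f j <= K * g j) -> 0 <= K ->
  (\sum_(j <oo) (g j)%:E < +oo)%E -> (\sum_(j <oo) (f j)%:E < +oo)%E.
Proof.
move=> f0 g0 fg K0 goo.
apply: (@le_lt_trans _ _ (K%:E * \sum_(j <oo) (g j)%:E)%E); last first.
  by rewrite lte_mul_pinfty.
rewrite -nneseriesZl; last by move=> j _; rewrite lee_fin.
by apply: lee_nneseries => j *; rewrite lee_fin ?f0// -EFinM lee_fin.
Qed.

Theorem theorem4p1 (R : realType) (k : scalar_kind)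
    (H : completeNormedModType (scalarField R k)) (dot : {dot H for @conjS R k})
    (hdot : norm_from_dot dot)
    (e : nat -> H) (he : orthonormal_basis dot e)
    (lam : nat -> R) (c : R) (c_gt0 : 0 < c) (hlam : forall j, c <= lam j ^+ 2)
    (T : R) (T_gt0 : 0 < T)
    (a : R -> R) (ha : log_lipschitz T a)
    (a0 : R) (a0_gt0 : 0 < a0) (ha0 : forall t : R, 0 <= t <= T -> a0 < a t)
    (s : R) :
  exists C delta : R, [/\ 0 < C, 0 < delta &
    forall u0 u1 : nat -> scalarField R k,
      sobolev lam dot e s u0 -> sobolev lam dot e (s - 1) u1 ->
    exists u du : R -> nat -> scalarField R k,
      [/\ cauchy_solution dot e lam T a u0 u1 (s - delta / 2 * T) u du,
          forall t : R, 0 <= t <= T ->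
            (sobolev_sqnorm lam (s - delta / 2 * T) (u t) +
             sobolev_sqnorm lam (s - delta / 2 * T - 1) (du t) <=
             C%:E * (sobolev_sqnorm lam s u0 +
                     sobolev_sqnorm lam (s - 1) u1))%E &
          forall (r : R) (v dv : R -> nat -> scalarField R k),
            cauchy_solution dot e lam T a u0 u1 r v dv ->
            forall t : R, 0 <= t <= T -> v t = u t /\ dv t = du t]].
Proof.
have [C [delta [C0 d0 est]]] := energy_estimate T_gt0 c_gt0 a0_gt0 ha ha0.
have [A aA] := log_lipschitz_bounded T_gt0 ha.
exists (2 * C), delta; split=> //; first by rewrite mulr_gt0.
set rho := s - delta / 2 * T.
move=> u0 u1 [u0s _] [u1s _].
pose b j := lam j ^+ 2.
have b0 j : 0 < b j by exact: lt_le_trans (hlam j).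
have A0 : 0 <= A.
  by apply: le_trans (aA 0 _); rewrite ?normr_ge0// lexx ltW.
(* A real fundamental system for each frequency serves both kinds of scalars:
   these enter only through the superposition [u] below. *)
have mode (x0 y0 : R) : exists F : nat -> R -> R, exists G : nat -> R -> R,
    forall j, [/\ F j 0 = x0, G j 0 = y0 & two_sided_oscillation T (b j) a (F j) (G j)].
  have /choice[FG FGP] : forall j, exists p : (R -> R) * (R -> R),
      [/\ p.1 0 = x0, p.2 0 = y0 & two_sided_oscillation T (b j) a p.1 p.2].
    move=> j; have [f [g fg]] := two_sided_oscillation_exists (b j) x0 y0 T_gt0 ha.
    by exists (f, g).
  by exists (fun j => (FG j).1), (fun j => (FG j).2).
have [f [f' fP]] := mode 1 0.
have [g [g' gP]] := mode 0 1.
pose P j := b j `^ (delta / 2 * T).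
have fE j t : 0 <= t <= T -> b j * f j t ^+ 2 + f' j t ^+ 2 <= C * P j * b j.
  move=> tT; have [f0 f'0 /two_sided_oscillationW fo] := fP j.
  have := est _ (hlam j) _ _ fo t tT.
  by rewrite f0 f'0 expr1n expr0n /= addr0 mulr1.
have gE j t : 0 <= t <= T -> b j * g j t ^+ 2 + g' j t ^+ 2 <= C * P j.
  move=> tT; have [g0 g'0 /two_sided_oscillationW go] := gP j.
  have := est _ (hlam j) _ _ go t tT.
  by rewrite g0 g'0 expr1n expr0n /= mulr0 add0r mulr1.
have f2 j t : 0 <= t <= T -> b j * f j t ^+ 2 <= C * P j * b j.
  by move=> /(fE j); apply: le_trans; rewrite lerDl sqr_ge0.
have g2 j t : 0 <= t <= T -> b j * g j t ^+ 2 <= C * P j.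
  by move=> /(gE j); apply: le_trans; rewrite lerDl sqr_ge0.
have f'2 j t : 0 <= t <= T -> f' j t ^+ 2 <= C * P j * b j.
  move=> /(fE j); apply: le_trans; rewrite lerDr.
  by apply: mulr_ge0; [exact: ltW|exact: sqr_ge0].
have g'2 j t : 0 <= t <= T -> g' j t ^+ 2 <= C * P j.
  move=> /(gE j); apply: le_trans; rewrite lerDr.
  by apply: mulr_ge0; [exact: ltW|exact: sqr_ge0].
(* [M] is the summand of the squared norms of the data. It dominates every series below
   up to a constant, since [b j `^ (rho - 1) * P j = b j `^ (s - 1)]. *)
pose M j := b j `^ s * absS (u0 j) ^+ 2 + b j `^ (s - 1) * absS (u1 j) ^+ 2.
have term0 r j (z : scalarField R k) : 0 <= b j `^ r * absS z ^+ 2.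
  by apply: mulr_ge0; [exact: powR_ge0|exact: sqr_ge0].
have M0 j : 0 <= M j by rewrite addr_ge0.
have Msum : (\sum_(j <oo) (M j)%:E =
    sobolev_sqnorm lam s u0 + sobolev_sqnorm lam (s - 1) u1)%E.
  by rewrite /sobolev_sqnorm -nneseriesD// => j _ _; rewrite lee_fin term0.
have Moo : (\sum_(j <oo) (M j)%:E < +oo)%E by rewrite Msum lte_add_pinfty.
have rhoP j : b j `^ (rho - 1) * P j = b j `^ (s - 1).
  rewrite /P -powRD; last by rewrite (gt_eqF (b0 j)) implybT.
  by congr (_ `^ _); rewrite /rho; ring.
have ME j : b j `^ (rho - 1) *
    (C * P j * b j * absS (u0 j) ^+ 2 + C * P j * absS (u1 j) ^+ 2) = C * M j.
  rewrite /M -(powRB1 s (b0 j)) -rhoP; ring.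
pose u t j := ofR k (f j t) * u0 j + ofR k (g j t) * u1 j.
pose du t j := ofR k (f' j t) * u0 j + ofR k (g' j t) * u1 j.
have uE t j : 0 <= t <= T -> b j `^ rho * absS (u t j) ^+ 2 +
    b j `^ (rho - 1) * absS (du t j) ^+ 2 <= 2 * C * M j.
  move=> tT; rewrite -(powRB1 rho (b0 j)) -mulrA -mulrDr -[leRHS]mulrA -ME.
  rewrite [leRHS]mulrCA ler_wpM2l ?powR_ge0//.
  have h1 := ler_wpM2l (ltW (b0 j)) (absS_comb_le (f j t) (g j t) (u0 j) (u1 j)).
  have h2 := absS_comb_le (f' j t) (g' j t) (u0 j) (u1 j).
  have h3 := ler_wpM2r (sqr_ge0 (absS (u0 j))) (fE j t tT).
  have h4 := ler_wpM2r (sqr_ge0 (absS (u1 j))) (gE j t tT).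
  rewrite (le_trans (lerD h1 h2))// -subr_ge0.
  by move: h3 h4; lra.
have u_lty t : 0 <= t <= T -> (sobolev_sqnorm lam rho (u t) < +oo)%E.
  move=> tT; apply: (nneseries_le_lty _ M0 _ _ Moo (K := 2 * C)) => [j|j|].
  - exact: term0.
  - by apply: le_trans (uE t j tT); rewrite lerDl term0.
  - by rewrite mulr_ge0// ltW.
have du_lty t : 0 <= t <= T -> (sobolev_sqnorm lam (rho - 1) (du t) < +oo)%E.
  move=> tT; apply: (nneseries_le_lty _ M0 _ _ Moo (K := 2 * C)) => [j|j|].
  - exact: term0.
  - by apply: le_trans (uE t j tT); rewrite lerDr term0.
  - by rewrite mulr_ge0// ltW.
have sol : cauchy_solution dot e lam T a u0 u1 rho u du.
  split.
  - by move=> t tT; apply: (sobolev_finite hdot he.1 c_gt0 hlam); exact: u_lty.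
  - by move=> t tT; apply: (sobolev_finite hdot he.1 c_gt0 hlam); exact: du_lty.
  - apply: (sobolev_derivative_series (al := fun j => C * P j * b j)
      (be := fun j => C * P j)) => // [j t tT|j t tT|].
    + by have [_ _ /(_ t tT)[]] := fP j.
    + by have [_ _ /(_ t tT)[]] := gP j.
    + under eq_eseriesr do rewrite ME.
      apply: (nneseries_le_lty _ M0 _ _ Moo (K := C)) => // [j|]; last exact: ltW.
      by apply: mulr_ge0 => //; exact: ltW.
  (* The second derivative multiplies the squared coefficients by at most
     [A ^+ 2 * b j ^+ 2], which the weight of order [rho - 2] compensates. *)
  - pose ddu (t : R) j := ofR k (- (a t * (b j * f j t))) * u0 j +
      ofR k (- (a t * (b j * g j t))) * u1 j.
    suff dd : sobolev_derivative lam T (rho - 2) du ddu.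
      rewrite (_ : ddu = (fun t j => - (ofR k (a t) * extA lam (u t) j))) in dd => //.
      by apply/funext => t; apply/funext => i; rewrite /ddu /extA /u !ofRN !ofRM; ring.
    have sq (x y : R) j t : 0 <= t <= T -> b j * x ^+ 2 <= y ->
        (- (a t * (b j * x))) ^+ 2 <= A ^+ 2 * (y * b j).
      move=> tT xy; rewrite sqrrN exprMn -(real_normK (num_real (a t))).
      apply: ler_pM; rewrite ?sqr_ge0//; first by rewrite ler_pXn2r ?nnegrE// aA.
      by rewrite exprMn expr2 -mulrA mulrC ler_wpM2r// ltW.
    apply: (sobolev_derivative_series (f := f') (g := g')
      (al := fun j => A ^+ 2 * (C * P j * b j * b j))
      (be := fun j => A ^+ 2 * (C * P j * b j))) => [j t tT|j t tT|j t tT|j t tT|].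
    + by have [_ _ /(_ t tT)[]] := fP j.
    + by have [_ _ /(_ t tT)[]] := gP j.
    + by apply: sq => //; exact: f2.
    + by apply: sq => //; exact: g2.
    + have E j : b j `^ (rho - 2) * (A ^+ 2 * (C * P j * b j * b j) * absS (u0 j) ^+ 2 +
          A ^+ 2 * (C * P j * b j) * absS (u1 j) ^+ 2) = A ^+ 2 * C * M j.
        rewrite -[RHS]mulrA -ME -(powRB1 (rho - 1) (b0 j)).
        rewrite (_ : rho - 1 - 1 = rho - 2); last by ring.
        by ring.
      under eq_eseriesr do rewrite E.
      have AC0 : 0 <= A ^+ 2 * C by apply: mulr_ge0; [exact: sqr_ge0|exact: ltW].
      apply: (nneseries_le_lty _ M0 _ _ Moo (K := A ^+ 2 * C)) => // j.
      exact: mulr_ge0.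
  - apply/funext => j; rewrite /u; have [-> _ _] := fP j; have [-> _ _] := gP j.
    by rewrite ofR1 ofR0 mul1r mul0r addr0.
  - apply/funext => j; rewrite /du; have [_ -> _] := fP j; have [_ -> _] := gP j.
    by rewrite ofR1 ofR0 mul1r mul0r add0r.
exists u, du; split=> //.
- move=> t tT; rewrite -Msum -nneseriesZl; last by move=> j _; rewrite lee_fin.
  rewrite /sobolev_sqnorm -nneseriesD; last 2 first.
    by move=> j _ _; rewrite lee_fin; exact: term0.
    by move=> j _ _; rewrite lee_fin; exact: term0.
  apply: lee_nneseries => [j _ _|j _]; first by apply: addr_ge0; exact: term0.
  by rewrite -EFinD -EFinM lee_fin; exact: uE.
- by move=> r v dv; exact: (cauchy_solution_unique T_gt0 c_gt0 hlam ha a0_gt0 ha0 sol).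
Qed.
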